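(* Let $(z,z',w,w')$ be admissible and $N\ge1$. Let $P_{z,z',w,w'\mid N}(t)$ be the Feller semigroup on $\mathbb S_N$ obtained by transporting, via the bijection $\nu\mapsto\mathbf n$ with $n_i=\nu_i+N-i$, the Feller semigroup on $\Omega_N$ whose generator is $D_{z,z',w,w'\mid N}$ with domain $\{f\in C_0(\Omega_N):D_{z,z',w,w'\mid N}f\in C_0(\Omega_N)\}$. Then the zw-measure $M_{z,z',w,w'\mid N}$ is a stationary distribution of the corresponding Feller process. That is, for all $t\ge0$ and $f\in C_0(\mathbb S_N)$, $$\sum_\nu M_{z,z',w,w'\mid N}(\nu)\,(P_{z,z',w,w'\mid N}(t)f)(\nu)=\sum_\nu M_{z,z',w,w'\mid N}(\nu)f(\nu).$$
   Context: Signatures and the state space: - $\mathbb S_N$ is the set of integer $N$-tuples $\nu_1\ge\dots\ge\nu_N$. - $\Omega_N=\{\mathbf n\in\mathbb Z^N:n_1>\dots>n_N\}$. - $V(\mathbf n)=\prod_{i<j}(n_i-n_j)$, and $\epsilon_k$ is the $k$th basis vector. The difference operator: $$(D_{z,z',w,w'\mid N}f)(\mathbf n)=\sum_{k=1}^N\Big(\frac{V(\mathbf n+\epsilon_k)}{V(\mathbf n)}(z+N-1-n_k)(z'+N-1-n_k)(f(\mathbf n+\epsilon_k)-f(\mathbf n))+\frac{V(\mathbf n-\epsilon_k)}{V(\mathbf n)}(w+n_k)(w'+n_k)(f(\mathbf n-\epsilon_k)-f(\mathbf n))\Big).$$ Such a Feller semigroup exists for admissible parameters. Admissibility: $(z,z',w,w')$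 is admissible if both of the following hold: - $(z+k)(z'+k)>0$ and $(w+k)(w'+k)>0$ for all $k\in\mathbb Z$; - $\mathrm{Re}(z+z'+w+w')>-1$. The zw-measure: - $\mathrm{Dim}_N\nu=\prod_{i<j}\frac{\nu_i-\nu_j-i+j}{j-i}$. - $M_{z,z',w,w'\mid N}(\nu)$ is proportional to $$\prod_{i=1}^N\frac{1}{\Gamma(z-\nu_i+i)\Gamma(z'-\nu_i+i)\Gamma(w+N+1+\nu_i-i)\Gamma(w'+N+1+\nu_i-i)}\,(\mathrm{Dim}_N\nu)^2,$$ normalized to be a probability measure on $\mathbb S_N$. *)

(* Defs.v *)
From Stdlib Require Import Reals Lra ZArith List Sorting.Sorted ClassicalEpsilon.
Import ListNotations.
Open Scope R_scope.

Definition Cx : Type := (R * R)%type.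
Definition Cre (a : Cx) : R := fst a.
Definition Cim (a : Cx) : R := snd a.
Definition Cadd (a b : Cx) : Cx := (fst a + fst b, snd a + snd b).
Definition Cmul (a b : Cx) : Cx :=
  (fst a * fst b - snd a * snd b, fst a * snd b + snd a * fst b).
Definition CofR (x : R) : Cx := (x, 0).
Definition CofZ (k : Z) : Cx := (IZR k, 0).
Definition Cexp (a : Cx) : Cx := (exp (fst a) * cos (snd a), exp (fst a) * sin (snd a)).
Definition Cscal (r : R) (a : Cx) : Cx := (r * fst a, r * snd a).

(* ---------- reciprocal Gamma function (Gauss limit formula) ----------
   1/Gamma(s) = lim_n  s (s+1) ... (s+n) * n^(-s) / n!                   *)
Fixpoint poch_prod (s : Cx) (n : nat) : Cx :=
  match n with
  | O => s
  | S m => Cmul (poch_prod s m) (Cadd s (CofR (INR n)))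
  end.
Definition gauss_seq (s : Cx) (n : nat) : Cx :=
  Cscal (/ INR (fact n))
    (Cmul (poch_prod s n) (Cexp (Cscal (- ln (INR n)) s))).
Definition Cx_cv (u : nat -> Cx) (l : Cx) : Prop :=
  Un_cv (fun n => fst (u n)) (fst l) /\ Un_cv (fun n => snd (u n)) (snd l).
(* the limit exists for every complex s; 1/Gamma is entire *)
Definition rgamma (s : Cx) : Cx :=
  epsilon (inhabits (0, 0)) (fun c => Cx_cv (gauss_seq s) c).

Definition prodR (l : list nat) (f : nat -> R) : R := fold_right (fun i acc => f i * acc) 1 l.
Definition sumN (l : list nat) (f : nat -> R) : R := fold_right (fun i acc => f i + acc) 0 l.
Definition prodC (l : list nat) (f : nat -> Cx) : Cx := fold_right (fun i acc => Cmul (f i) acc) (1, 0) l.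
Definition sumL (F : list (list Z)) (g : list Z -> R) : R := fold_right (fun x acc => g x + acc) 0 F.

Definition ent (v : list Z) (i : nat) : Z := nth i v 0%Z.

Definition inS (N : nat) (nu : list Z) : Prop :=
  length nu = N /\ Sorted (fun a b => (a >= b)%Z) nu.
Definition inOmega (N : nat) (n : list Z) : Prop :=
  length n = N /\ Sorted (fun a b => (a > b)%Z) n.

Fixpoint shift (c d : Z) (l : list Z) : list Z :=
  match l with
  | [] => []
  | x :: l' => (x + c)%Z :: shift (c + d)%Z d l'
  end.
(* nu |-> n with n_i = nu_i + N - i (1-based i) *)
Definition toOmega (N : nat) (nu : list Z) : list Z := shift (Z.of_nat N - 1)%Z (-1)%Z nu.
Definition toS (N : nat) (n : list Z) : list Z := shift (1 - Z.of_nat N)%Z 1%Z n.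

Fixpoint addk (k : nat) (d : Z) (l : list Z) : list Z :=
  match k, l with
  | _, [] => []
  | O, x :: l' => (x + d)%Z :: l'
  | S k', x :: l' => x :: addk k' d l'
  end.

Definition Vdm (N : nat) (n : list Z) : R :=
  prodR (seq 0 N) (fun i => prodR (seq (S i) (N - S i))
     (fun j => IZR (ent n i - ent n j))).

(* ---------- the difference operator D_{z,z',w,w'|N} ----------
   Under admissibility the coefficients (z+N-1-n_k)(z'+N-1-n_k) and
   (w+n_k)(w'+n_k) are real; we take their real parts. *)
Definition Dop (z z' w w' : Cx) (N : nat) (f : list Z -> R) (n : list Z) : R :=
  sumN (seq 0 N) (fun k =>
    Vdm N (addk k 1 n) / Vdm N n
      * Cre (Cmul (Cadd z (CofZ (Z.of_nat N - 1 - ent n k)))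
                  (Cadd z' (CofZ (Z.of_nat N - 1 - ent n k))))
      * (f (addk k 1 n) - f n)
    + Vdm N (addk k (-1) n) / Vdm N n
      * Cre (Cmul (Cadd w (CofZ (ent n k))) (Cadd w' (CofZ (ent n k))))
      * (f (addk k (-1) n) - f n)).

Definition realpos (a : Cx) : Prop := Cim a = 0 /\ Cre a > 0.
Definition admissible (z z' w w' : Cx) : Prop :=
  (forall k : Z, realpos (Cmul (Cadd z (CofZ k)) (Cadd z' (CofZ k)))) /\
  (forall k : Z, realpos (Cmul (Cadd w (CofZ k)) (Cadd w' (CofZ k)))) /\
  Cre (Cadd (Cadd z z') (Cadd w w')) > -1.

Definition C0 (Dm : list Z -> Prop) (f : list Z -> R) : Prop :=
  forall eps, eps > 0 -> exists F : list (list Z),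
    forall x, Dm x -> ~ In x F -> Rabs (f x) < eps.

Definition unif_lim0 (Dm : list Z -> Prop) (h : R -> list Z -> R) (g : list Z -> R) : Prop :=
  forall eps, eps > 0 -> exists delta, delta > 0 /\
    forall t, 0 < t < delta -> forall x, Dm x -> Rabs (h t x - g x) <= eps.

(* P t : C_0(Dm) -> C_0(Dm), functions being identified when equal on Dm *)
Definition Feller_semigroup (Dm : list Z -> Prop) (P : R -> (list Z -> R) -> list Z -> R) : Prop :=
  (forall t f, 0 <= t -> C0 Dm f -> C0 Dm (P t f)) /\
  (forall t f g, 0 <= t -> C0 Dm f -> (forall x, Dm x -> f x = g x) ->
      forall x, Dm x -> P t f x = P t g x) /\
  (forall t a b f g, 0 <= t -> C0 Dm f -> C0 Dm g ->
      forall x, Dm x -> P t (fun y => a * f y + b * g y) x = a * P t f x + b * P t g x) /\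
  (forall t f, 0 <= t -> C0 Dm f -> (forall x, Dm x -> 0 <= f x <= 1) ->
      forall x, Dm x -> 0 <= P t f x <= 1) /\
  (forall f, C0 Dm f -> forall x, Dm x -> P 0 f x = f x) /\
  (forall s t f, 0 <= s -> 0 <= t -> C0 Dm f ->
      forall x, Dm x -> P (s + t) f x = P s (P t f) x) /\
  (forall f, C0 Dm f -> unif_lim0 Dm (fun t => P t f) f).

Definition gen_at (Dm : list Z -> Prop) (P : R -> (list Z -> R) -> list Z -> R)
    (f g : list Z -> R) : Prop :=
  C0 Dm g /\ unif_lim0 Dm (fun t x => (P t f x - f x) / t) g.

Definition generator_is (Dm : list Z -> Prop) (P : R -> (list Z -> R) -> list Z -> R)
    (D : (list Z -> R) -> list Z -> R) : Prop :=
  forall f g, C0 Dm f ->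
    (gen_at Dm P f g <-> (C0 Dm (D f) /\ forall x, Dm x -> g x = D f x)).

Definition has_sum (Dm : list Z -> Prop) (g : list Z -> R) (s : R) : Prop :=
  forall eps, eps > 0 -> exists F0 : list (list Z), Forall Dm F0 /\
    forall F, NoDup F -> Forall Dm F -> incl F0 F -> Rabs (sumL F g - s) < eps.

Definition DimN (N : nat) (nu : list Z) : R :=
  prodR (seq 0 N) (fun i => prodR (seq (S i) (N - S i))
     (fun j => (IZR (ent nu i - ent nu j) - INR i + INR j) / (INR j - INR i))).

(* unnormalized weight; i below is 0-based, so the paper's i is i+1.
   The product of the four reciprocal Gamma values is real under admissibility. *)
Definition zw_weight (z z' w w' : Cx) (N : nat) (nu : list Z) : R :=
  Cre (prodC (seq 0 N) (fun i =>
     let a := (ent nu i)%Z in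
     Cmul (Cmul (rgamma (Cadd z (CofZ (- a + Z.of_nat i + 1))))
                (rgamma (Cadd z' (CofZ (- a + Z.of_nat i + 1)))))
          (Cmul (rgamma (Cadd w (CofZ (Z.of_nat N + a - Z.of_nat i))))
                (rgamma (Cadd w' (CofZ (Z.of_nat N + a - Z.of_nat i)))))))
  * (DimN N nu) ^ 2.

Definition zw_total (z z' w w' : Cx) (N : nat) : R :=
  epsilon (inhabits 0) (has_sum (inS N) (zw_weight z z' w w' N)).

Definition zw_measure (z z' w w' : Cx) (N : nat) (nu : list Z) : R :=
  zw_weight z z' w w' N nu / zw_total z z' w w' N.

Definition transportS (N : nat) (P : R -> (list Z -> R) -> list Z -> R)
    (t : R) (f : list Z -> R) (nu : list Z) : R :=
  P t (fun n => f (toS N n)) (toOmega N nu).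

(* Main.v *)
(* Written in the coordinates n_i = nu_i + N - i, the zw-weight is a constant multiple of
   M(n) = V(n)^2 prod_i om(n_i), where V is the Vandermonde product and om is determined by the ratio
   om(x+1)/om(x) = (z+N-1-x)(z'+N-1-x) / ((w+x+1)(w'+x+1)); this uses only 1/Gamma(s) = s/Gamma(s+1).
   The total mass is finite by Raabe's test, which is where Re(z+z'+w+w') > -1 enters, and M satisfies
   detailed balance with the jump rates of D.

   To get sum M Df = 0 for every f in the domain, and not only for finitely supported f, put
   phi(n) = 1 + sum n_i^2 and psi_T = T/(T+phi).  Since M phi psi_T is summable, detailed balance gives
   sum M (psi_T Df - f D psi_T) = 0.  The symmetric sums sum_k V(n +- e_k)/V(n) n_k^m are polynomials of
   degree m in n, and the cubic terms of D phi cancel, hence |D psi_T| <= C phi/(T+phi); let T -> oo.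

   If f is finitely supported then D P_t f = P_t D f, so sum M P_t D f = 0 and
   |sum M (P_(t+h) f - P_t f)| <= h eps sum M uniformly in t once h is small; subdividing [0,t] gives
   stationarity for such f, and these are dense in C_0. *)
From Stdlib Require Import Reals Lra Lia ZArith Permutation Sorted ClassicalEpsilon Classical.
From Coquelicot Require Import Coquelicot.
(* [List] comes last because Coquelicot has its own [Forall]. *)
From Stdlib Require Import List.
Require Import Defs.
Import ListNotations.
Open Scope R_scope.
Set Bullet Behavior "Strict Subproofs".

(** * Unordered sums *)

(** The semigroup does not preserve finite support, so stationarity needs the sum of [M Df] to
    vanish on the whole domain of the generator. There [f] decays at no prescribed rate, the jump
    rates grow quadratically and [M] may have barely finite mass: [M Df] is summable, but its single
    terms, rate times value, need not be, and the sum cannot be rearranged directly. The factor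
    [psi_T] decays like 1/[phi] and compensates exactly this quadratic growth. The price is
    [D psi_T]. A termwise estimate has a rate of order x^2 against an increment of order x
    T/(T+phi)^2, and misses the required bound phi/(T+phi) by a factor of order sqrt(T). The
    cancellation of cubic terms removes this loss; it rests on both rates having leading coefficient
    1. It is not visible coordinate by coordinate: when coordinates stay close together, V(n +-
    e_k)/V(n) does not tend to 1, and only the sum over k behaves like a polynomial. Partial
    fractions give this sum a recursion on the number of points. *)

Lemma sumL_cons a F g : sumL (a :: F) g = g a + sumL F g.
Proof. reflexivity. Qed.

Lemma sumL_ext F g h : (forall x, In x F -> g x = h x) -> sumL F g = sumL F h.
Proof.
  induction F as [|a F IH]; intros H; [reflexivity|]. cbn.
  rewrite H by now left. f_equal. apply IH. intros x Hx. apply H. now right.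
Qed.

Lemma sumL_app F G g : sumL (F ++ G) g = sumL F g + sumL G g.
Proof. induction F as [|a F IH]; [symmetry; apply Rplus_0_l|]. rewrite <- app_comm_cons, !sumL_cons, IH. ring. Qed.

Lemma sumL_lin F g h a b :
  sumL F (fun x => a * g x + b * h x) = a * sumL F g + b * sumL F h.
Proof.
  induction F as [|c F IH]; [cbn; ring|]. rewrite !sumL_cons, IH. ring.
Qed.

Lemma sumL_scal F g a : sumL F (fun x => a * g x) = a * sumL F g.
Proof. rewrite (sumL_ext F _ (fun x => a * g x + 0 * g x)), sumL_lin by (intros; ring). ring. Qed.

Lemma sumL_le F g h : (forall x, In x F -> g x <= h x) -> sumL F g <= sumL F h.
Proof.
  induction F as [|c F IH]; intros H; cbn; [lra|].
  apply Rplus_le_compat; [apply H; now left|]. apply IH. intros x Hx. apply H. now right.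
Qed.

Lemma sumL_zero F g : (forall x, In x F -> g x = 0) -> sumL F g = 0.
Proof.
  intros H. rewrite (sumL_ext F g (fun x => 0 * g x)), sumL_scal; [ring|].
  intros x Hx. rewrite H by assumption. ring.
Qed.

Lemma sumL_nonneg F g : (forall x, In x F -> 0 <= g x) -> 0 <= sumL F g.
Proof.
  intros H. rewrite <- (sumL_zero F (fun _ => 0)) by reflexivity. now apply sumL_le.
Qed.

Lemma sumL_Rabs F g : Rabs (sumL F g) <= sumL F (fun x => Rabs (g x)).
Proof.
  induction F as [|c F IH]; cbn; [rewrite Rabs_R0; lra|].
  eapply Rle_trans; [apply Rabs_triang|]. apply Rplus_le_compat_l. exact IH.
Qed.

Lemma sumL_map F s g : sumL (map s F) g = sumL F (fun x => g (s x)).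
Proof. induction F as [|c F IH]; cbn; [reflexivity|]. now f_equal. Qed.

Lemma sumL_perm F G g : Permutation F G -> sumL F g = sumL G g.
Proof. induction 1; rewrite ?sumL_cons; lra. Qed.

Lemma sumL_incl F G g : NoDup F -> incl F G -> (forall x, In x G -> 0 <= g x) ->
  sumL F g <= sumL G g.
Proof.
  revert G. induction F as [|a F IH]; intros G HF HI Hg.
  - now apply sumL_nonneg.
  - inversion HF as [|? ? Ha HF']; subst.
    destruct (in_split a G (HI a (or_introl eq_refl))) as (G1 & G2 & ->).
    rewrite (sumL_perm (G1 ++ a :: G2) (a :: G1 ++ G2)) by (symmetry; apply Permutation_middle).
    cbn. apply Rplus_le_compat_l. apply IH; [assumption| |].
    + intros x Hx. assert (Hx' := HI x (or_intror Hx)).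
      apply in_app_or in Hx'. apply in_or_app. destruct Hx' as [|[->|]]; tauto.
    + intros x Hx. apply Hg. apply in_app_or in Hx. apply in_or_app. cbn. tauto.
Qed.

Definition lZ_dec : forall x y : list Z, {x = y} + {x <> y} := list_eq_dec Z.eq_dec.

(** [F] is kept as a literal prefix, so that a sum over the union splits into the sum over [F] and a
    remainder. *)
Definition list_union (F G : list (list Z)) : list (list Z) :=
  F ++ filter (fun y => if in_dec lZ_dec y F then false else true) (nodup lZ_dec G).

Lemma in_list_union F G x : In x (list_union F G) <-> In x F \/ In x G.
Proof.
  unfold list_union. rewrite in_app_iff, filter_In, nodup_In.
  destruct (in_dec lZ_dec x F); intuition congruence.
Qed.

Lemma NoDup_list_union F G : NoDup F -> NoDup (list_union F G).
Proof.
  intros HF. unfold list_union. apply NoDup_app; [assumption| |].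
  - apply NoDup_filter, NoDup_nodup.
  - intros x Hx Hx'. apply filter_In in Hx'. destruct (in_dec lZ_dec x F); intuition congruence.
Qed.

Lemma sumL_union F G g :
  sumL (list_union F G) g = sumL F g +
    sumL (filter (fun y => if in_dec lZ_dec y F then false else true) (nodup lZ_dec G)) g.
Proof. apply sumL_app. Qed.

Definition summable (Dm : list Z -> Prop) (g : list Z -> R) : Prop :=
  exists B, forall F, NoDup F -> Forall Dm F -> sumL F (fun x => Rabs (g x)) <= B.

Lemma summable_dom Dm g h c : summable Dm h -> 0 <= c ->
  (forall x, Dm x -> Rabs (g x) <= c * Rabs (h x)) -> summable Dm g.
Proof.
  intros [B HB] Hc H. exists (c * B). intros F HF HD.
  apply Rle_trans with (sumL F (fun x => c * Rabs (h x))).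
  - apply sumL_le. intros x Hx. apply H. rewrite Forall_forall in HD. now apply HD.
  - rewrite sumL_scal. apply Rmult_le_compat_l; [assumption|]. now apply HB.
Qed.

Lemma has_sum_ext Dm g h s : (forall x, Dm x -> g x = h x) -> has_sum Dm g s -> has_sum Dm h s.
Proof.
  intros E H eps He. destruct (H eps He) as (F0 & HF0 & HF). exists F0. split; [assumption|].
  intros F N1 N2 N3. rewrite <- (sumL_ext F g); [now apply HF|].
  intros x Hx. apply E. rewrite Forall_forall in N2. now apply N2.
Qed.

Lemma has_sum_lin Dm g h s t a b : has_sum Dm g s -> has_sum Dm h t ->
  has_sum Dm (fun x => a * g x + b * h x) (a * s + b * t).
Proof.
  intros Hg Hh eps He.
  set (c := Rabs a + Rabs b + 1).
  assert (Pa := Rabs_pos a). assert (Pb := Rabs_pos b).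
  assert (Hc : 0 < eps / c) by (apply Rdiv_lt_0_compat; unfold c; lra).
  destruct (Hg _ Hc) as (F1 & D1 & H1). destruct (Hh _ Hc) as (F2 & D2 & H2).
  exists (F1 ++ F2). split; [now apply Forall_app|].
  intros F N1 N2 N3. rewrite sumL_lin.
  specialize (H1 F N1 N2 (fun x Hx => N3 x (in_or_app F1 F2 x (or_introl Hx)))).
  specialize (H2 F N1 N2 (fun x Hx => N3 x (in_or_app F1 F2 x (or_intror Hx)))).
  replace (a * sumL F g + b * sumL F h - (a * s + b * t))
    with (a * (sumL F g - s) + b * (sumL F h - t)) by ring.
  eapply Rle_lt_trans; [apply Rabs_triang|]. rewrite !Rabs_mult.
  apply Rle_lt_trans with (Rabs a * (eps / c) + Rabs b * (eps / c)).
  - apply Rplus_le_compat; apply Rmult_le_compat_l; lra.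
  - apply Rlt_le_trans with (c * (eps / c)); [unfold c at 3|right; unfold c; field; lra].
    assert (0 < eps / c) by assumption. nra.
Qed.

Lemma has_sum_scal Dm g s a : has_sum Dm g s -> has_sum Dm (fun x => a * g x) (a * s).
Proof.
  intros H. assert (H' := has_sum_lin Dm g g s s a 0 H H).
  replace (a * s) with (a * s + 0 * s) by ring. revert H'. apply has_sum_ext. intros; ring.
Qed.

Lemma has_sum_zero Dm : has_sum Dm (fun _ => 0) 0.
Proof.
  intros eps He. exists []. split; [constructor|]. intros F _ _ _.
  rewrite sumL_zero by reflexivity. rewrite Rminus_diag, Rabs_R0. assumption.
Qed.

Lemma has_sum_bound Dm g s B : has_sum Dm g s ->
  (forall F, NoDup F -> Forall Dm F -> sumL F (fun x => Rabs (g x)) <= B) -> Rabs s <= B.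
Proof.
  intros H HB. apply le_epsilon. intros eps He.
  destruct (H eps He) as (F0 & D0 & H0).
  assert (HN : Forall Dm (nodup lZ_dec F0)).
  { rewrite Forall_forall in *. intros x Hx. apply D0. now apply nodup_In in Hx. }
  specialize (H0 (nodup lZ_dec F0) (NoDup_nodup _ _) HN
    (fun x Hx => proj2 (nodup_In lZ_dec F0 x) Hx)).
  specialize (HB _ (NoDup_nodup lZ_dec F0) HN).
  assert (H1 := sumL_Rabs (nodup lZ_dec F0) g).
  revert H0 H1 HB. unfold Rabs. repeat destruct Rcase_abs; lra.
Qed.

Lemma has_sum_unique Dm g s t : has_sum Dm g s -> has_sum Dm g t -> s = t.
Proof.
  intros Hs Ht. assert (H := has_sum_lin Dm g g s t 1 (-1) Hs Ht).
  assert (Rabs (1 * s + -1 * t) <= 0).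
  { apply (has_sum_bound _ _ _ _ H). intros F _ _. right. apply sumL_zero. intros x _.
    rewrite <- Rabs_R0. f_equal. ring. }
  revert H0. unfold Rabs. destruct Rcase_abs; lra.
Qed.

(** The sum is the supremum of the finite partial sums; a finite set within [eps] of it serves as
    [F0], since enlarging it can only increase the partial sum. *)
Lemma nonneg_has_sum Dm g : (forall x, Dm x -> 0 <= g x) -> summable Dm g -> exists s, has_sum Dm g s.
Proof.
  intros Hg [B HB].
  set (E := fun r => exists F, NoDup F /\ Forall Dm F /\ r = sumL F g).
  destruct (completeness E) as [s [Hub Hlub]].
  - exists B. intros r (F & N1 & N2 & ->). eapply Rle_trans; [|apply (HB F N1 N2)].
    apply sumL_le. intros. apply Rle_abs.
  - exists 0, []. repeat constructor.
  - exists s. intros eps He.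
    destruct (classic (exists r, E r /\ s - eps < r)) as [(r & (F0 & N1 & N2 & ->) & Hr)|Hn].
    + exists F0. split; [assumption|]. intros F M1 M2 M3.
      assert (sumL F g <= s) by (apply Hub; now exists F).
      assert (sumL F0 g <= sumL F g).
      { apply sumL_incl; try assumption. rewrite Forall_forall in M2. auto. }
      unfold Rabs. destruct Rcase_abs; lra.
    + exfalso. assert (s <= s - eps); [|lra]. apply Hlub. intros r Hr.
      destruct (Rle_dec r (s - eps)); [assumption|]. exfalso. apply Hn. exists r. split; [assumption|lra].
Qed.

Lemma summable_has_sum Dm g : summable Dm g -> exists s, has_sum Dm g s.
Proof.
  intros H.
  destruct (nonneg_has_sum Dm (fun x => Rmax (g x) 0)) as [s Hs].
  - intros. apply Rmax_r.
  - apply (summable_dom Dm _ g 1 H); [lra|]. intros x _.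
    unfold Rmax. destruct Rle_dec; rewrite ?Rabs_R0; assert (P := Rabs_pos (g x)); lra.
  - destruct (nonneg_has_sum Dm (fun x => Rmax (- g x) 0)) as [t Ht].
    + intros. apply Rmax_r.
    + apply (summable_dom Dm _ g 1 H); [lra|]. intros x _.
      unfold Rmax. destruct Rle_dec; rewrite ?Rabs_R0, ?Rabs_Ropp; assert (P := Rabs_pos (g x)); lra.
    + exists (1 * s + -1 * t). generalize (has_sum_lin _ _ _ _ _ 1 (-1) Hs Ht).
      apply has_sum_ext. intros x _. unfold Rmax. repeat destruct Rle_dec; lra.
Qed.

(** The image of [s] only has to cover the support of [g]. This one form serves for the shifts
    [addk], for the passage between signatures and Omega, and for dropping lists outside Omega,
    where the weight vanishes. *)
Lemma has_sum_reindex (D1 D2 : list Z -> Prop) (s t : list Z -> list Z) g v :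
  (forall x, D1 x -> D2 (s x)) -> (forall x, D1 x -> t (s x) = x) ->
  (forall y, D2 y -> g y <> 0 -> D1 (t y) /\ s (t y) = y) ->
  has_sum D2 g v -> has_sum D1 (fun x => g (s x)) v.
Proof.
  intros Hs Hts Hst H eps He. destruct (H eps He) as (F0 & A0 & B0).
  set (nz := fun y => if Req_EM_T (g y) 0 then false else true).
  exists (map t (filter nz F0)). split.
  - rewrite Forall_forall in *. intros x Hx. apply in_map_iff in Hx. destruct Hx as (y & <- & Hy).
    apply filter_In in Hy. destruct Hy as [Hy Hy']. unfold nz in Hy'.
    destruct Req_EM_T; [discriminate|]. now apply Hst; [apply A0|].
  - intros F N1 N2 N3. rewrite <- sumL_map.
    assert (M1 : NoDup (map s F)).
    { apply NoDup_map_NoDup_ForallPairs; [|assumption]. intros x y Hx Hy E.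
      rewrite Forall_forall in N2. rewrite <- (Hts x), <- (Hts y) by auto. now f_equal. }
    (* The image of [F] may miss points of [F0], so the union is tested instead; the points added
       carry [g = 0], because every point of [F0] with [g] nonzero was pulled back into [F]. *)
    assert (M2 : Forall D2 (list_union (map s F) F0)).
    { rewrite Forall_forall in *. intros y Hy. apply in_list_union in Hy.
      destruct Hy as [Hy|Hy]; [|now apply A0].
      apply in_map_iff in Hy. destruct Hy as (x & <- & Hx). now apply Hs, N2. }
    specialize (B0 _ (NoDup_list_union _ F0 M1) M2
       (fun y Hy => proj2 (in_list_union _ _ y) (or_intror Hy))).
    rewrite sumL_union in B0. rewrite (sumL_zero (filter _ _)) in B0.
    + now rewrite Rplus_0_r in B0.
    + intros y Hy. apply filter_In in Hy. destruct Hy as [Hy Hy'].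
      destruct in_dec as [|Hn]; [discriminate|]. apply nodup_In in Hy.
      apply NNPP. intros Hg. apply Hn. rewrite Forall_forall in A0.
      destruct (Hst y (A0 y Hy) Hg) as [_ E]. rewrite <- E. apply in_map. apply N3.
      apply in_map. apply filter_In. split; [assumption|]. unfold nz. now destruct Req_EM_T.
Qed.

(** * The reciprocal Gamma function *)

(** The expansion f(n) = 1 + c/n + O(1/n^2). The coefficients add under products, and coefficient 0
    is what makes an infinite product converge. *)
Definition expand1 (f : nat -> C) (c : C) : Prop :=
  exists K n0, forall n, (n0 <= n)%nat -> (1 <= n)%nat ->
    Cmod (f n - (1 + c * RtoC (/ INR n)))%C <= K * (/ INR n) ^ 2.

Lemma inv_INR_bound n : (1 <= n)%nat -> 0 < / INR n <= 1.
Proof.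
  intros H. apply le_INR in H. cbn in H. split; [apply Rinv_0_lt_compat; lra|].
  rewrite <- Rinv_1. apply Rinv_le_contravar; lra.
Qed.

Lemma expand1_mult f g c d : expand1 f c -> expand1 g d -> expand1 (fun n => f n * g n)%C (c + d)%C.
Proof.
  intros (K & n0 & HK) (L & n1 & HL).
  exists (Cmod c * Cmod d + (K * (1 + Cmod d) + (L * (1 + Cmod c) + K * L))), (Nat.max n0 n1).
  intros n Hn Hn1. assert (Hx := inv_INR_bound n Hn1).
  specialize (HK n ltac:(lia) Hn1). specialize (HL n ltac:(lia) Hn1).
  set (x := / INR n) in *.
  set (e := (f n - (1 + c * RtoC x))%C) in *. set (e' := (g n - (1 + d * RtoC x))%C) in *.
  replace (f n * g n - (1 + (c + d) * RtoC x))%C with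
    (c * d * RtoC (x ^ 2) + (e * (1 + d * RtoC x) + (e' * (1 + c * RtoC x) + e * e')))%C
    by (unfold e, e'; rewrite RtoC_pow; ring).
  assert (P1 := Cmod_ge_0 c). assert (P2 := Cmod_ge_0 d).
  assert (P3 := Cmod_ge_0 e). assert (P4 := Cmod_ge_0 e').
  assert (Hx2 : 0 < x ^ 2 <= 1) by (split; nra).
  assert (PK : 0 <= K) by nra. assert (PL : 0 <= L) by nra.
  assert (T1 : forall b, Cmod (1 + b * RtoC x)%C <= 1 + Cmod b).
  { intros b. eapply Rle_trans; [apply Cmod_triangle|]. rewrite Cmod_1, Cmod_mult, Cmod_R.
    rewrite (Rabs_pos_eq x) by lra. assert (P := Cmod_ge_0 b). nra. }
  eapply Rle_trans; [apply Cmod_triangle|]. rewrite !Rmult_plus_distr_r. apply Rplus_le_compat.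
  { rewrite !Cmod_mult, Cmod_R, Rabs_pos_eq by lra. lra. }
  eapply Rle_trans; [apply Cmod_triangle|]. apply Rplus_le_compat.
  { rewrite Cmod_mult. specialize (T1 d). assert (P := Cmod_ge_0 (1 + d * RtoC x)%C).
    replace (K * (1 + Cmod d) * x ^ 2) with ((K * x ^ 2) * (1 + Cmod d)) by ring.
    apply Rmult_le_compat; lra. }
  eapply Rle_trans; [apply Cmod_triangle|]. apply Rplus_le_compat.
  { rewrite Cmod_mult. specialize (T1 c). assert (P := Cmod_ge_0 (1 + c * RtoC x)%C).
    replace (L * (1 + Cmod c) * x ^ 2) with ((L * x ^ 2) * (1 + Cmod c)) by ring.
    apply Rmult_le_compat; lra. }
  rewrite Cmod_mult. apply Rle_trans with ((K * x ^ 2) * (L * x ^ 2)).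
  - apply Rmult_le_compat; lra.
  - assert (0 <= K * L) by nra. assert (0 <= K * L * x ^ 2) by nra. nra.
Qed.

Lemma Cmod_le_Re_Im (a : C) : Cmod a <= Rabs (fst a) + Rabs (snd a).
Proof.
  destruct a as [a b]. cbn [fst snd].
  replace (a, b) with (RtoC a + Ci * RtoC b)%C.
  - eapply Rle_trans; [apply Cmod_triangle|]. rewrite Cmod_mult, !Cmod_R, Cmod_Ci. lra.
  - unfold Cplus, Cmult, Ci, RtoC; cbn. f_equal; ring.
Qed.

(** The upper bound comes from exp(-x) >= 1 - x, that is exp(x)(1-x) <= 1, together with
    (1+x+2x^2)(1-x) = 1 + x^2(1-2x) >= 1 for x <= 1/2. *)
Lemma exp_bounds x : Rabs x <= / 2 -> Rabs (exp x - (1 + x)) <= 2 * x ^ 2.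
Proof.
  intros H. assert (H1 := exp_ineq1_le x). assert (H2 := exp_ineq1_le (- x)).
  assert (Hx : - / 2 <= x <= / 2) by (revert H; unfold Rabs; destruct Rcase_abs; lra).
  rewrite Rabs_pos_eq by lra.
  assert (E : exp x * exp (- x) = 1) by (rewrite <- exp_plus, Rplus_opp_r; apply exp_0).
  assert (P := exp_pos x).
  assert (exp x * (1 - x) <= 1) by nra.
  assert ((1 + x + 2 * x ^ 2) * (1 - x) >= 1) by nra.
  nra.
Qed.

Lemma abs_sin_le x : Rabs (sin x) <= Rabs x.
Proof.
  destruct (Rtotal_order x 0) as [H|[->|H]].
  - assert (H1 := sin_lt_x (- x) ltac:(lra)). rewrite sin_neg in H1.
    assert (H2 := SIN_bound x).
    assert (H3 : sin x <= - x).
    { destruct (Rle_dec 1 (- x)); [lra|].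
      assert (0 < sin (- x)) by (apply sin_gt_0; assert (Q := PI2_1); lra).
      rewrite sin_neg in H0. lra. }
    unfold Rabs; repeat destruct Rcase_abs; lra.
  - rewrite sin_0. lra.
  - assert (H1 := sin_lt_x x H).
    assert (H2 := SIN_bound x).
    assert (H3 : - sin x <= x).
    { destruct (Rle_dec 1 x); [lra|].
      assert (0 < sin x) by (apply sin_gt_0; assert (Q := PI2_1); lra). lra. }
    unfold Rabs; repeat destruct Rcase_abs; lra.
Qed.

Lemma cos_bounds x : 0 <= 1 - cos x <= x ^ 2.
Proof.
  replace x with (2 * (x / 2)) at 1 2 by field. rewrite cos_2a_sin.
  assert (H := abs_sin_le (x / 2)).
  assert (H2 : Rsqr (sin (x / 2)) <= Rsqr (x / 2)) by now apply Rsqr_le_abs_1.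
  unfold Rsqr in *. split; nra.
Qed.

Lemma sin_bounds x : Rabs x <= 1 -> Rabs (sin x - x) <= x ^ 2.
Proof.
  intros Hx.
  destruct (MVT_gen (fun t => sin t - t) 0 x (fun t => cos t - 1)) as (c & Hc & E).
  - intros t _. auto_derive; [trivial|ring].
  - intros t _. apply continuity_pt_minus; [apply continuity_sin|apply continuity_pt_id].
  - rewrite sin_0 in E. replace (sin x - x) with ((cos c - 1) * x) by lra.
    rewrite Rabs_mult. assert (B := cos_bounds c).
    rewrite (Rabs_left1 (cos c - 1)) by lra.
    assert (Hcx : c ^ 2 <= Rabs x).
    { assert (Rabs c <= Rabs x).
      { revert Hc. unfold Rmin, Rmax, Rabs. repeat destruct Rle_dec; repeat destruct Rcase_abs; lra. }
      assert (P := Rabs_pos c). rewrite <- pow2_abs. nra. }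
    assert (P := Rabs_pos x). rewrite <- (pow2_abs x). nra.
Qed.

Lemma ln_succ_bounds n : (1 <= n)%nat ->
  / INR n - (/ INR n) ^ 2 <= ln (INR (S n)) - ln (INR n) <= / INR n.
Proof.
  intros Hn. assert (Hx := inv_INR_bound n Hn). apply le_INR in Hn. cbn in Hn.
  rewrite S_INR, <- ln_div by lra.
  replace ((INR n + 1) / INR n) with (1 + / INR n) by (field; lra).
  set (x := / INR n) in *. split.
  (* Since (1+x)(1-x+x^2) = 1+x^3, the number 1/(1+x) is at most 1-x+x^2, hence at most
     exp(-(x-x^2)). *)
  - assert (H : / (1 + x) <= exp (- (x - x ^ 2))).
    { assert (E := exp_ineq1_le (- (x - x ^ 2))).
      assert (/ (1 + x) <= 1 + - (x - x ^ 2)); [|lra].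
      apply (Rmult_le_reg_l (1 + x)); [lra|]. rewrite Rinv_r by lra. nra. }
    rewrite <- (ln_exp (x - x ^ 2)). apply ln_le; [apply exp_pos|].
    rewrite exp_Ropp in H. apply Rinv_le_contravar in H; [|apply Rinv_0_lt_compat; lra].
    rewrite !Rinv_inv in H. exact H.
  - apply Rle_trans with (ln (exp x)); [|rewrite ln_exp; lra]. apply ln_le; [lra|]. apply exp_ineq1_le.
Qed.

(** The ratio (n+1)^(-s) / n^(-s), the exponential part of one step of the Gauss sequence. *)
Definition Cn_step (s : C) (n : nat) : C := Cexp (Cscal (- (ln (INR (S n)) - ln (INR n))) s).

Lemma expand1_exp_step s : expand1 (Cn_step s) (- s)%C.
Proof.
  destruct s as [a b].
  (* The first bracket bounds the error of the real part, the second that of the imaginary part. *)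
  exists ((2 * Rabs b ^ 2 + 2 * Rabs a ^ 2 + Rabs a) + (2 * Rabs b ^ 2 + Rabs b + Rabs b * (2 * Rabs a ^ 2 + Rabs a))).
  (* From [n0] on, |a|/n and |b|/n are at most 1/2, the range in which [exp_bounds] and [sin_bounds]
     apply. *)
  destruct (INR_unbounded (2 * (1 + Rabs a + Rabs b))) as [n0 Hn0].
  exists n0. intros n Hn Hn1. assert (Hx := inv_INR_bound n Hn1).
  assert (Hd := ln_succ_bounds n Hn1). unfold Cn_step.
  set (d := ln (INR (S n)) - ln (INR n)) in *.
  apply le_INR in Hn. apply le_INR in Hn1. cbn in Hn1.
  assert (Pa := Rabs_pos a). assert (Pb := Rabs_pos b).
  assert (Hsm : (1 + Rabs a + Rabs b) * / INR n <= / 2).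
  { apply (Rmult_le_reg_r (INR n)); [lra|]. rewrite Rmult_assoc, Rinv_l by lra. lra. }
  set (x := / INR n) in *.
  assert (Hd0 : 0 <= d) by nra.
  assert (Had : Rabs (- d * a) <= Rabs a * x).
  { rewrite Rabs_mult, Rabs_Ropp, (Rabs_pos_eq d) by lra. nra. }
  assert (Hbd : Rabs (- d * b) <= Rabs b * x).
  { rewrite Rabs_mult, Rabs_Ropp, (Rabs_pos_eq d) by lra. nra. }
  assert (He := exp_bounds (- d * a) ltac:(nra)).
  assert (Hc := cos_bounds (- d * b)).
  assert (Hs := sin_bounds (- d * b) ltac:(nra)).
  assert (Qa : (- d * a) ^ 2 <= Rabs a ^ 2 * x ^ 2).
  { rewrite <- (pow2_abs (- d * a)). assert (P := Rabs_pos (- d * a)). nra. }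
  assert (Qb : (- d * b) ^ 2 <= Rabs b ^ 2 * x ^ 2).
  { rewrite <- (pow2_abs (- d * b)). assert (P := Rabs_pos (- d * b)). nra. }
  eapply Rle_trans; [apply Cmod_le_Re_Im|]. cbn -[pow Rabs].
  set (ad := - d * a) in *. set (bd := - d * b) in *.
  set (E := exp ad) in *.
  assert (HE : 0 < E <= 2).
  { split; [apply exp_pos|]. revert He Had Qa Hsm. generalize (Rabs a ^ 2). intros.
    assert (Rabs ad <= / 2) by nra.
    assert (ad ^ 2 <= / 4). { rewrite <- (pow2_abs ad). assert (P := Rabs_pos ad). nra. }
    revert He H. unfold Rabs. repeat destruct Rcase_abs; lra. }
  assert (Haa : Rabs (ad + a * x) <= Rabs a * x ^ 2).
  { replace (ad + a * x) with (a * (x - d)) by (unfold ad; ring).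
    rewrite Rabs_mult. apply Rmult_le_compat_l; [lra|]. rewrite Rabs_pos_eq; lra. }
  assert (Hbb : Rabs (bd + b * x) <= Rabs b * x ^ 2).
  { replace (bd + b * x) with (b * (x - d)) by (unfold bd; ring).
    rewrite Rabs_mult. apply Rmult_le_compat_l; [lra|]. rewrite Rabs_pos_eq; lra. }
  assert (Hre : Rabs (E * cos bd + - (1 + (- a * x - - b * 0)))
     <= (2 * Rabs b ^ 2 + 2 * Rabs a ^ 2 + Rabs a) * x ^ 2).
  { replace (E * cos bd + - (1 + (- a * x - - b * 0)))
      with (- (E * (1 - cos bd)) + ((E - (1 + ad)) + (ad + a * x))) by ring.
    eapply Rle_trans; [apply Rabs_triang|].
    assert (Rabs (- (E * (1 - cos bd))) <= 2 * (Rabs b ^ 2 * x ^ 2)).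
    { rewrite Rabs_Ropp, Rabs_pos_eq by nra. apply Rmult_le_compat; lra. }
    assert (T := Rabs_triang (E - (1 + ad)) (ad + a * x)). lra. }
  assert (Him : Rabs (E * sin bd + - (0 + (- a * 0 + - b * x)))
     <= (2 * Rabs b ^ 2 + Rabs b + Rabs b * (2 * Rabs a ^ 2 + Rabs a)) * x ^ 2).
  { replace (E * sin bd + - (0 + (- a * 0 + - b * x)))
      with (E * (sin bd - bd) + ((E - (1 + ad)) * bd + (ad * bd + (bd + b * x)))) by ring.
    eapply Rle_trans; [apply Rabs_triang|].
    assert (Rabs (E * (sin bd - bd)) <= 2 * (Rabs b ^ 2 * x ^ 2)).
    { rewrite Rabs_mult, (Rabs_pos_eq E) by lra.
      apply Rmult_le_compat; [lra|apply Rabs_pos|lra|lra]. }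
    assert (Rabs ((E - (1 + ad)) * bd) <= (2 * Rabs a ^ 2 * x ^ 2) * (Rabs b * 1)).
    { rewrite Rabs_mult. apply Rmult_le_compat; try apply Rabs_pos; nra. }
    assert (Rabs (ad * bd) <= (Rabs a * x) * (Rabs b * x)).
    { rewrite Rabs_mult. apply Rmult_le_compat; try apply Rabs_pos; nra. }
    assert (T := Rabs_triang ((E - (1 + ad)) * bd) (ad * bd + (bd + b * x))).
    assert (T' := Rabs_triang (ad * bd) (bd + b * x)). lra. }
  eapply Rle_trans; [apply Rplus_le_compat; [apply Hre|apply Him]|].
  rewrite <- Rmult_plus_distr_r. apply Rle_refl.
Qed.

Lemma Cexp_plus a b : Cexp (Cadd a b) = Cmul (Cexp a) (Cexp b).
Proof.
  destruct a, b. unfold Cexp, Cadd, Cmul; cbn [fst snd].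
  rewrite exp_plus, cos_plus, sin_plus. f_equal; ring.
Qed.

Lemma Cexp_real x : Cexp (CofR x) = RtoC (exp x).
Proof.
  unfold Cexp, CofR, RtoC; cbn [fst snd]. rewrite cos_0, sin_0. f_equal; ring.
Qed.

Lemma gauss_seq_step s n :
  gauss_seq s (S n) = (gauss_seq s n * ((1 + s * RtoC (/ INR (S n))) * Cn_step s n))%C.
Proof.
  unfold gauss_seq, Cn_step.
  assert (E : Cexp (Cscal (- ln (INR (S n))) s) =
    Cmul (Cexp (Cscal (- ln (INR n)) s)) (Cexp (Cscal (- (ln (INR (S n)) - ln (INR n))) s))).
  { rewrite <- Cexp_plus. f_equal. destruct s; unfold Cscal, Cadd; cbn [fst snd]. f_equal; ring. }
  rewrite E. clear E.
  generalize (Cexp (Cscal (- ln (INR n)) s)) (Cexp (Cscal (- (ln (INR (S n)) - ln (INR n))) s)).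
  intros u v.
  assert (H1 := INR_fact_neq_0 n).
  assert (H2 : INR (S n) <> 0) by (apply not_0_INR; lia).
  cbn [poch_prod]. rewrite fact_simpl, mult_INR.
  generalize dependent (INR (fact n)). generalize dependent (INR (S n)). generalize (poch_prod s n).
  intros [p1 p2] N HN f Hf. destruct s as [a b], u as [u1 u2], v as [v1 v2].
  unfold Cscal, Cmul, Cadd, CofR, Cmult, Cplus, RtoC; cbn [fst snd].
  f_equal; field; split; assumption.
Qed.

Lemma Cmod_1_plus_le f K x : Cmod (f - 1)%C <= K * x -> Cmod f <= 1 + K * x.
Proof.
  intros H. replace f with (1 + (f - 1))%C by ring.
  eapply Rle_trans; [apply Cmod_triangle|]. rewrite Cmod_1. lra.
Qed.

(** The factors are 1 + O(1/n^2), and [v] telescopes a majorant of 1/n^2. So |u| exp(K v) does not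
    increase, which bounds [u] by some [B]; then the increments of [u] are at most B K times those
    of [v], and both components are Cauchy. *)
Lemma expand1_prod_cv (u f : nat -> C) :
  (forall n, u (S n) = (u n * f n)%C) -> expand1 f (RtoC 0) -> exists l, Cx_cv u l.
Proof.
  intros Hu (K0 & n0 & HK0).
  set (K := Rabs K0). assert (PK : 0 <= K) by apply Rabs_pos.
  assert (HK : forall n, (n0 <= n)%nat -> (1 <= n)%nat -> Cmod (f n - 1)%C <= K * (/ INR n) ^ 2).
  { intros n H1 H2. replace (f n - 1)%C with (f n - (1 + RtoC 0 * RtoC (/ INR n)))%C by ring.
    eapply Rle_trans; [now apply HK0|]. apply Rmult_le_compat_r; [apply pow2_ge_0|apply Rle_abs]. }
  clear HK0.
  (* [v m = 1/(m+n0+1)], so that [1/n^2 <= v m - v (m+1)] at [n = m+n0+2] *)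
  set (N := fun m => (m + (n0 + 2))%nat). set (v := fun m => / INR (m + (n0 + 1))).
  assert (Hv : forall m, (/ INR (N m)) ^ 2 <= v m - v (S m) /\ 0 < v m <= 1).
  { intros m. unfold N, v.
    replace (m + (n0 + 2))%nat with (S (m + (n0 + 1))) by lia.
    replace (S m + (n0 + 1))%nat with (S (m + (n0 + 1))) by lia.
    assert (Q := inv_INR_bound (m + (n0 + 1)) ltac:(lia)). split; [|exact Q].
    assert (Hp : 1 <= INR (m + (n0 + 1))) by (apply (le_INR 1); lia).
    rewrite S_INR. set (y := INR (m + (n0 + 1))) in *.
    replace (/ y - / (y + 1)) with (/ (y * (y + 1))) by (field; lra).
    rewrite pow_inv. apply Rinv_le_contravar; nra. }
  assert (Hstep : forall m, Cmod (u (N (S m))) * exp (K * v (S m)) <= Cmod (u (N m)) * exp (K * v m)).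
  { intros m. change (N (S m)) with (S (N m)). rewrite Hu, Cmod_mult.
    assert (H1 := Cmod_1_plus_le _ _ _ (HK (N m) ltac:(unfold N; lia) ltac:(unfold N; lia))).
    destruct (Hv m) as [H2 _].
    replace (K * v m) with (K * (v m - v (S m)) + K * v (S m)) by ring. rewrite exp_plus.
    assert (H3 := exp_ineq1_le (K * (v m - v (S m)))).
    assert (P1 := Cmod_ge_0 (u (N m))). assert (P2 := exp_pos (K * v (S m))).
    rewrite <- Rmult_assoc. apply Rmult_le_compat_r; [lra|]. apply Rmult_le_compat_l; [lra|]. nra. }
  set (B := Cmod (u (N 0%nat)) * exp (K * v 0%nat)).
  assert (HB : forall m, Cmod (u (N m)) * exp (K * v m) <= B).
  { induction m as [|m IH]; [apply Rle_refl|]. eapply Rle_trans; [apply Hstep|exact IH]. }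
  assert (HB' : forall m, Cmod (u (N m)) <= B).
  { intros m. eapply Rle_trans; [|apply (HB m)]. assert (P := Cmod_ge_0 (u (N m))).
    assert (Q := exp_ineq1_le (K * v m)). destruct (Hv m). assert (0 <= K * v m) by (apply Rmult_le_pos; lra). assert (1 <= exp (K * v m)) by lra. nra. }
  assert (PB : 0 <= B) by (eapply Rle_trans; [apply Cmod_ge_0|apply (HB' 0%nat)]).
  assert (Hd : forall m k, Cmod (u (N (m + k)%nat) - u (N m))%C <= B * K * (v m - v (m + k)%nat)).
  { intros m. induction k as [|k IH].
    - rewrite Nat.add_0_r. replace (u (N m) - u (N m))%C with (RtoC 0) by ring.
      rewrite Cmod_0. lra.
    - rewrite Nat.add_succ_r.
      replace (u (N (S (m + k))) - u (N m))%C
        with ((u (N (m + k)%nat) * (f (N (m + k)%nat) - 1)) + (u (N (m + k)%nat) - u (N m)))%C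
        by (change (N (S (m + k))) with (S (N (m + k)%nat)); rewrite Hu; ring).
      eapply Rle_trans; [apply Cmod_triangle|]. rewrite Cmod_mult.
      assert (H1 := HK (N (m + k)%nat) ltac:(unfold N; lia) ltac:(unfold N; lia)).
      destruct (Hv (m + k)%nat) as [H2 _]. assert (H3 := HB' (m + k)%nat).
      assert (P1 := Cmod_ge_0 (u (N (m + k)%nat))).
      assert (P2 := Cmod_ge_0 (f (N (m + k)%nat) - 1)%C).
      assert (Cmod (u (N (m + k)%nat)) * Cmod (f (N (m + k)%nat) - 1)%C <= B * (K * (v (m + k)%nat - v (S (m + k))))).
      { apply Rmult_le_compat; try lra. eapply Rle_trans; [apply H1|]. now apply Rmult_le_compat_l. }
      lra. }
  assert (Hcomp : forall p : C -> R, (forall a b, p (a - b)%C = p a - p b) ->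
     (forall a, Rabs (p a) <= Cmod a) -> exists l, Un_cv (fun n => p (u n)) l).
  { intros p Hp Hpb.
    assert (Hc : Cauchy_crit (fun n => p (u n))).
    { intros eps He.
      assert (Hsmall : exists m, B * K * v m < eps / 2).
      { destruct (INR_unbounded (2 * (B * K) / eps)) as [m Hm]. exists m. unfold v.
        assert (PP : 0 <= B * K) by nra.
        rewrite plus_INR. assert (HP : 1 <= INR (n0 + 1)) by (apply (le_INR 1); lia).
        assert (P0 := pos_INR m).
        apply (Rmult_lt_reg_r (INR m + INR (n0 + 1))); [lra|].
        rewrite Rmult_assoc, Rinv_l by lra.
        apply (Rmult_lt_compat_r (eps / 2)) in Hm; [|lra].
        replace (2 * (B * K) / eps * (eps / 2)) with (B * K) in Hm by (field; lra). nra. }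
      destruct Hsmall as [m Hm]. exists (N m).
      assert (G : forall n, (n >= N m)%nat -> Rabs (p (u n) - p (u (N m))) < eps / 2).
      { intros n Hn. rewrite <- Hp. eapply Rle_lt_trans; [apply Hpb|].
        replace n with (N (m + (n - N m))%nat) by (unfold N in *; lia).
        eapply Rle_lt_trans; [apply Hd|]. eapply Rle_lt_trans; [|exact Hm].
        apply Rmult_le_compat_l; [nra|]. destruct (Hv (m + (n - N m))%nat). lra. }
      intros n k Hn Hk. assert (G1 := G n Hn). assert (G2 := G k Hk).
      unfold Rdist. revert G1 G2. unfold Rabs. repeat destruct Rcase_abs; lra. }
    destruct (Rcomplete.R_complete _ Hc) as [l Hl]. now exists l. }
  destruct (Hcomp fst) as [l1 H1]; [intros [] []; reflexivity| |].
  { intros a. eapply Rle_trans; [apply Rmax_l|apply Rmax_Cmod]. }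
  destruct (Hcomp snd) as [l2 H2]; [intros [] []; reflexivity| |].
  { intros a. eapply Rle_trans; [apply Rmax_r|apply Rmax_Cmod]. }
  exists (l1, l2). now split.
Qed.

Lemma expand1_affine_succ s : expand1 (fun n => 1 + s * RtoC (/ INR (S n)))%C s.
Proof.
  exists (Cmod s), 0%nat. intros n _ Hn. assert (Hx := inv_INR_bound n Hn).
  apply le_INR in Hn. cbn in Hn. rewrite S_INR.
  replace (1 + s * RtoC (/ (INR n + 1)) - (1 + s * RtoC (/ INR n)))%C
    with (s * (RtoC (/ (INR n + 1)) - RtoC (/ INR n)))%C by ring.
  rewrite <- RtoC_minus, Cmod_mult, Cmod_R. apply Rmult_le_compat_l; [apply Cmod_ge_0|].
  replace (/ (INR n + 1) - / INR n) with (- (/ (INR n * (INR n + 1)))) by (field; lra).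
  rewrite Rabs_Ropp, Rabs_pos_eq by (left; apply Rinv_0_lt_compat; nra).
  rewrite pow_inv. apply Rinv_le_contravar; nra.
Qed.

(** [rgamma] is chosen by [epsilon], so nothing can be said of it until the limit is known to exist.
    One step of the Gauss sequence multiplies by 1+s/(n+1) and by ((n+1)/n)^(-s), whose first-order
    coefficients s and -s cancel. *)
Lemma rgamma_cv s : Cx_cv (gauss_seq s) (rgamma s).
Proof.
  unfold rgamma. apply epsilon_spec.
  apply (expand1_prod_cv _ (fun n => (1 + s * RtoC (/ INR (S n))) * Cn_step s n)%C (gauss_seq_step s)).
  replace (RtoC 0) with (s + - s)%C by ring.
  apply expand1_mult; [apply expand1_affine_succ|apply expand1_exp_step].
Qed.

Lemma poch_prod_succ s n :
  Cmul s (poch_prod (Cadd s (CofR 1)) n) = Cmul (poch_prod s n) (Cadd s (CofR (INR (S n)))).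
Proof.
  induction n as [|n IH].
  - reflexivity.
  - cbn [poch_prod].
    replace (Cmul s (Cmul (poch_prod (Cadd s (CofR 1)) n) (Cadd (Cadd s (CofR 1)) (CofR (INR (S n))))))
      with (Cmul (Cmul s (poch_prod (Cadd s (CofR 1)) n)) (Cadd (Cadd s (CofR 1)) (CofR (INR (S n))))).
    + rewrite IH. rewrite (S_INR (S n)). generalize (poch_prod s n). intros [p1 p2].
      destruct s. unfold Cmul, Cadd, CofR; cbn [fst snd]. f_equal; ring.
    + generalize (poch_prod (Cadd s (CofR 1)) n). intros [p1 p2].
      destruct s. unfold Cmul, Cadd, CofR; cbn [fst snd]. f_equal; ring.
Qed.

(** The functional equation before the limit: the two products differ by the factor s+n+1 and the
    two powers by n, and (s+n+1)/n = 1+(s+1)/n tends to 1. *)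
Lemma gauss_seq_shift s n : (1 <= n)%nat ->
  (gauss_seq s n * (1 + (s + 1) * RtoC (/ INR n)) = s * gauss_seq (s + 1) n)%C.
Proof.
  intros Hn. unfold gauss_seq.
  assert (E : Cexp (Cscal (- ln (INR n)) (s + 1)%C) = (Cexp (Cscal (- ln (INR n)) s) * RtoC (/ INR n))%C).
  { replace (RtoC (/ INR n)) with (Cexp (CofR (- ln (INR n)))).
    - change Cmult with Cmul. rewrite <- Cexp_plus. f_equal.
      destruct s; unfold Cscal, Cadd, Cplus, CofR, RtoC; cbn [fst snd]. f_equal; ring.
    - rewrite Cexp_real, exp_Ropp, exp_ln; [reflexivity|]. apply lt_0_INR. lia. }
  rewrite E. assert (P := poch_prod_succ s n).
  change (Cadd s (CofR 1)) with (s + 1)%C in P. rewrite S_INR in P.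
  assert (HN : INR n <> 0) by (apply not_0_INR; lia).
  generalize dependent (poch_prod (s + 1)%C n). generalize dependent (poch_prod s n).
  generalize (Cexp (Cscal (- ln (INR n)) s)). intros u p p' P.
  assert (Q : forall a : R, forall b : C, Cscal a b = (RtoC a * b)%C).
  { intros a [b c]. unfold Cscal, Cmult, RtoC; cbn [fst snd]. f_equal; ring. }
  rewrite !Q. change Cmul with Cmult in *. change Cadd with Cplus in *. change CofR with RtoC in *.
  replace (s * (RtoC (/ INR (fact n)) * (p' * (u * RtoC (/ INR n)))))%C
    with (RtoC (/ INR (fact n)) * ((s * p') * (u * RtoC (/ INR n))))%C by ring.
  rewrite P.
  rewrite RtoC_plus.
  replace (RtoC 1) with (RtoC (INR n) * RtoC (/ INR n))%C at 1.
  - ring.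
  - rewrite <- RtoC_mult, Rinv_r by assumption. reflexivity.
Qed.

Lemma rgamma_succ (s : C) : rgamma s = (s * rgamma (s + 1))%C.
Proof.
  destruct (rgamma_cv s) as [A1 A2]. destruct (rgamma_cv (s + 1)%C) as [B1 B2].
  apply is_lim_seq_Reals in A1, A2, B1, B2.
  assert (L0 : is_lim_seq (fun n => / INR n) 0).
  { replace (Finite 0) with (Rbar_inv p_infty) by reflexivity.
    apply is_lim_seq_inv; [apply is_lim_seq_INR|discriminate]. }
  destruct s as [a b].
  assert (L1 : is_lim_seq (fun n => 1 + (a + 1) * / INR n) 1).
  { replace (Finite 1) with (Finite (1 + (a + 1) * 0)) by (f_equal; ring).
    apply (is_lim_seq_plus' _ _ _ _ (is_lim_seq_const 1)).
    apply (is_lim_seq_scal_l _ (a + 1) _ L0). }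
  assert (L2 : is_lim_seq (fun n => b * / INR n) 0).
  { replace (Finite 0) with (Finite (b * 0)) by (f_equal; ring).
    apply (is_lim_seq_scal_l _ b _ L0). }
  assert (EQ : forall n, (1 <= n)%nat ->
    (gauss_seq (a, b) n * (1 + ((a, b) + 1) * RtoC (/ INR n)) = (a, b) * gauss_seq ((a, b) + 1) n)%C)
    by apply gauss_seq_shift.
  set (g := gauss_seq (a, b)) in *. set (h := gauss_seq ((a, b) + 1)%C) in *.
  set (G := rgamma (a, b)) in *. set (H := rgamma ((a, b) + 1)%C) in *.
  assert (U : forall (x y : nat -> R) (l m : R), is_lim_seq x l -> is_lim_seq y m ->
     (forall n, (1 <= n)%nat -> x n = y n) -> l = m).
  { intros x y l m Hx Hy E.
    assert (Hx' : is_lim_seq y l).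
    { apply (is_lim_seq_ext_loc x); [|assumption]. exists 1%nat. exact E. }
    apply is_lim_seq_unique in Hx'. apply is_lim_seq_unique in Hy. congruence. }
  apply injective_projections.
  - replace (fst G) with (fst G * 1 - snd G * 0) by ring.
    apply (U (fun n => fst (g n) * (1 + (a + 1) * / INR n) - snd (g n) * (b * / INR n))
             (fun n => a * fst (h n) - b * snd (h n))).
    + apply is_lim_seq_minus'; apply is_lim_seq_mult'; assumption.
    + apply is_lim_seq_minus'; apply is_lim_seq_mult'; try assumption; apply is_lim_seq_const.
    + intros n Hn. assert (E := f_equal fst (EQ n Hn)). unfold Cmult, Cplus, RtoC in E. cbn [fst snd] in E. rewrite ?Rplus_0_r, ?Rmult_0_r, ?Rminus_0_r in E. lra.
  - replace (snd G) with (fst G * 0 + snd G * 1) by ring.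
    apply (U (fun n => fst (g n) * (b * / INR n) + snd (g n) * (1 + (a + 1) * / INR n))
             (fun n => a * snd (h n) + b * fst (h n))).
    + apply is_lim_seq_plus'; apply is_lim_seq_mult'; assumption.
    + apply is_lim_seq_plus'; apply is_lim_seq_mult'; try assumption; apply is_lim_seq_const.
    + intros n Hn. assert (E := f_equal snd (EQ n Hn)). unfold Cmult, Cplus, RtoC in E. cbn [fst snd] in E. rewrite ?Rplus_0_r, ?Rmult_0_r, ?Rminus_0_r in E. lra.
Qed.

(** * One-particle weights *)

(** Recursion in both directions from the value 1 at 0. Building the weight from its ratio makes it
    real and positive at once; the product of Gamma values, complex a priori, is compared with it
    only at the end. *)
Lemma exists_ratio (rho : Z -> R) : (forall x, 0 < rho x) ->
  exists om : Z -> R, (forall x, 0 < om x) /\ forall x, om (x + 1)%Z = om x * rho x.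
Proof.
  intros Hr.
  set (up := fix up n := match n with O => 1 | S m => up m * rho (Z.of_nat m) end).
  set (dn := fix dn n := match n with O => 1 | S m => dn m / rho (- Z.of_nat m - 1)%Z end).
  assert (Pu : forall n, 0 < up n).
  { induction n; cbn; [lra|]. apply Rmult_lt_0_compat; auto. }
  assert (Pd : forall n, 0 < dn n).
  { induction n; cbn; [lra|]. apply Rdiv_lt_0_compat; auto. }
  exists (fun x => if Z_le_dec 0 x then up (Z.to_nat x) else dn (Z.to_nat (- x))). split.
  - intros x. destruct Z_le_dec; auto.
  - intros x. destruct (Z_le_dec 0 x) as [H|H], (Z_le_dec 0 (x + 1)) as [H'|H']; try lia.
    + replace (Z.to_nat (x + 1)) with (S (Z.to_nat x)) by lia. cbn. now rewrite Z2Nat.id.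
    + replace x with (-1)%Z by lia. change (1 = 1 / rho (-1)%Z * rho (-1)%Z). field. apply Rgt_not_eq, Hr.
    + replace (Z.to_nat (- x)) with (S (Z.to_nat (- (x + 1)))) by lia. cbn.
      replace (- Z.of_nat (Z.to_nat (- (x + 1))) - 1)%Z with x by lia.
      field. apply Rgt_not_eq, Hr.
Qed.

(** * Raabe's test and the tails of the one-particle weight *)

Definition sum_upto (a : nat -> R) (n : nat) : R := fold_right (fun i acc => a i + acc) 0 (seq 0 n).

Lemma sum_upto_S a n : sum_upto a (S n) = sum_upto a n + a n.
Proof.
  unfold sum_upto. rewrite seq_S, fold_right_app. cbn.
  generalize (seq 0 n). induction l as [|x l IH]; cbn; [ring|]. rewrite IH. ring.
Qed.

(** With [c] half the gap between [A] and -1, the ratio condition gives c a(n) <= (n-1) a(n) - n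
    a(n+1) for large n, and the right side telescopes. *)
Lemma raabe (a : nat -> R) (A : R) : (forall n, 0 < a n) -> A < -1 ->
  is_lim_seq (fun n => INR n * (a (S n) / a n - 1)) A ->
  exists B, forall n, sum_upto a n <= B.
Proof.
  intros Ha HA HL. set (c := (-1 - A) / 2).
  assert (Hc : 0 < c) by (unfold c; lra).
  apply is_lim_seq_spec in HL. destruct (HL (mkposreal c Hc)) as [n0 Hn0]. cbn in Hn0.
  set (n1 := S n0).
  assert (Hstep : forall n, (n1 <= n)%nat -> c * a n <= (INR n - 1) * a n - INR n * a (S n)).
  { intros n Hn. specialize (Hn0 n ltac:(unfold n1 in *; lia)).
    assert (E : INR n * a (S n) = (INR n * (a (S n) / a n - 1)) * a n + INR n * a n)
      by (field; apply Rgt_not_eq, Ha).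
    rewrite E. set (t := INR n * (a (S n) / a n - 1)) in *.
    assert (t <= -1 - c) by (revert Hn0; unfold c, Rabs; destruct Rcase_abs; lra).
    specialize (Ha n). nra. }
  assert (Hsum : forall k, c * sum_upto a (n1 + k) + (INR (n1 + k) - 1) * a (n1 + k)%nat
     <= c * sum_upto a n1 + (INR n1 - 1) * a n1).
  { induction k as [|k IH]; [rewrite Nat.add_0_r; lra|].
    rewrite Nat.add_succ_r, sum_upto_S, S_INR.
    specialize (Hstep (n1 + k)%nat ltac:(lia)). lra. }
  set (B := (c * sum_upto a n1 + (INR n1 - 1) * a n1) / c).
  exists B. intros n.
  assert (Hmono : forall m k, sum_upto a m <= sum_upto a (m + k)).
  { intros m. induction k; [rewrite Nat.add_0_r; lra|]. rewrite Nat.add_succ_r, sum_upto_S.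
    specialize (Ha (m + k)%nat). lra. }
  eapply Rle_trans; [apply (Hmono n n1)|]. rewrite Nat.add_comm.
  specialize (Hsum n). unfold B. apply (Rmult_le_reg_l c); [assumption|].
  replace (c * ((c * sum_upto a n1 + (INR n1 - 1) * a n1) / c))
    with (c * sum_upto a n1 + (INR n1 - 1) * a n1) by (field; lra).
  assert (1 <= INR (n1 + n)) by (apply (le_INR 1); unfold n1; lia).
  specialize (Ha (n1 + n)%nat). nra.
Qed.

(** The expansion r(n) = 1 + A/n + o(1/n) used by Raabe's test; [A] adds under products. *)
Definition ratio_lim (r : nat -> R) (A : R) : Prop := is_lim_seq (fun n => INR n * (r n - 1)) A.

Lemma lim_inv_INR : is_lim_seq (fun n => / INR n) 0.
Proof.
  replace (Finite 0) with (Rbar_inv p_infty) by reflexivity.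
  apply is_lim_seq_inv; [apply is_lim_seq_INR|discriminate].
Qed.

Lemma ratio_lim_1 r A : ratio_lim r A -> is_lim_seq r 1.
Proof.
  intros H. assert (H' := is_lim_seq_mult' _ _ _ _ lim_inv_INR H).
  assert (H2 := is_lim_seq_plus' _ _ _ _ (is_lim_seq_const 1) H').
  replace (1 + 0 * A) with 1 in H2 by ring. revert H2.
  apply is_lim_seq_ext_loc. exists 1%nat. intros n Hn. field. apply not_0_INR. lia.
Qed.

Lemma ratio_lim_mult r s A B : ratio_lim r A -> ratio_lim s B -> ratio_lim (fun n => r n * s n) (A + B).
Proof.
  intros Hr Hs. assert (H1 := ratio_lim_1 s B Hs).
  assert (H := is_lim_seq_plus' _ _ _ _ (is_lim_seq_mult' _ _ _ _ Hr H1) Hs).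
  replace (A * 1 + B) with (A + B) in H by ring.
  revert H. apply is_lim_seq_ext. intros n. ring.
Qed.

Lemma ratio_lim_pow r A k : ratio_lim r A -> ratio_lim (fun n => r n ^ k) (INR k * A).
Proof.
  intros H. induction k as [|k IH].
  - apply (is_lim_seq_ext (fun _ => 0)); [intros; cbn; ring|].
    replace (INR 0 * A) with 0 by (cbn; ring). apply is_lim_seq_const.
  - rewrite S_INR. replace ((INR k + 1) * A) with (A + INR k * A) by ring.
    apply (ratio_lim_mult r (fun n => r n ^ k)); assumption.
Qed.

Lemma ratio_lim_quad a b c d : (forall n : nat, INR n ^ 2 + c * INR n + d <> 0) ->
  ratio_lim (fun n => (INR n ^ 2 + a * INR n + b) / (INR n ^ 2 + c * INR n + d)) (a - c).
Proof.
  intros Hd.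
  assert (L : forall x y z, is_lim_seq (fun n => x + y * / INR n + z * (/ INR n * / INR n)) x).
  { intros x y z. replace (Finite x) with (Finite (x + y * 0 + z * (0 * 0))) by (f_equal; ring).
    apply is_lim_seq_plus'.
    - apply is_lim_seq_plus'; [apply is_lim_seq_const|].
      apply is_lim_seq_mult'; [apply is_lim_seq_const|apply lim_inv_INR].
    - apply is_lim_seq_mult'; [apply is_lim_seq_const|].
      apply is_lim_seq_mult'; apply lim_inv_INR. }
  assert (H := is_lim_seq_div' _ _ _ _ (L (a - c) (b - d) 0) (L 1 c d) R1_neq_R0).
  rewrite Rdiv_1_r in H. revert H. apply is_lim_seq_ext_loc. exists 1%nat. intros n Hn.
  specialize (Hd n). assert (INR n <> 0) by (apply not_0_INR; lia).
  field. repeat split; assumption.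
Qed.

Lemma ratio_lim_succ : ratio_lim (fun n => (INR n + 2) / (INR n + 1)) 1.
Proof.
  assert (H : is_lim_seq (fun n => 1 / (1 + 1 * / INR n)) (1 / (1 + 1 * 0))).
  { apply is_lim_seq_div'; [apply is_lim_seq_const| |lra].
    apply is_lim_seq_plus'; [apply is_lim_seq_const|].
    apply is_lim_seq_mult'; [apply is_lim_seq_const|apply lim_inv_INR]. }
  replace (1 / (1 + 1 * 0)) with 1 in H by field. revert H.
  apply is_lim_seq_ext_loc. exists 1%nat. intros n Hn.
  assert (0 < INR n) by (apply lt_0_INR; lia). field. lra.
Qed.

(* The factor [(1+|x|)^k] absorbs the squared Vandermonde, with [k = 2(N-1)]. *)
Lemma one_particle_summable (om : Z -> R) (p1 p0 q1 q0 : R) (k : nat) :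
  let p := fun x => IZR x ^ 2 + p1 * IZR x + p0 in
  let q := fun x => IZR x ^ 2 + q1 * IZR x + q0 in
  (forall x, 0 < p x) -> (forall x, 0 < q x) -> (forall x, 0 < om x) ->
  (forall x, om (x + 1)%Z * q (x + 1)%Z = om x * p x) ->
  p1 - q1 - 2 + INR k < -1 ->
  exists B, forall n,
    sum_upto (fun i => om (Z.of_nat i) * (1 + Rabs (IZR (Z.of_nat i))) ^ k) n <= B /\
    sum_upto (fun i => om (- Z.of_nat i)%Z * (1 + Rabs (IZR (- Z.of_nat i)%Z)) ^ k) n <= B.
Proof.
  intros p q Hp Hq Hom Hrel HA.
  assert (Hw : forall x, 0 < (1 + Rabs x) ^ k).
  { intros x. apply pow_lt. assert (P := Rabs_pos x). lra. }
  assert (HS : forall n : nat, ((1 + INR (S n)) ^ k / (1 + INR n) ^ k) = ((INR n + 2) / (INR n + 1)) ^ k).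
  { intros n. assert (P := pos_INR n). unfold Rdiv. rewrite Rpow_mult_distr, pow_inv, S_INR.
    f_equal; [f_equal; ring|]. f_equal. f_equal. ring. }
  (* The ratio of weights is p(n)/q(n+1), and the shift raises the linear coefficient of [q] to
     [q1 + 2]. The polynomial factor contributes [k]. *)
  destruct (raabe (fun i => om (Z.of_nat i) * (1 + Rabs (IZR (Z.of_nat i))) ^ k) (p1 - (q1 + 2) + INR k * 1))
    as [B1 H1].
  { intros n. apply Rmult_lt_0_compat; auto. }
  { lra. }
  { assert (L : ratio_lim (fun n => (INR n ^ 2 + p1 * INR n + p0) / (INR n ^ 2 + (q1 + 2) * INR n + (1 + q1 + q0))
        * ((INR n + 2) / (INR n + 1)) ^ k) (p1 - (q1 + 2) + INR k * 1)).
    { apply ratio_lim_mult; [apply ratio_lim_quad|apply ratio_lim_pow, ratio_lim_succ].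
      intros n. replace (INR n ^ 2 + (q1 + 2) * INR n + (1 + q1 + q0)) with (q (Z.of_nat n + 1)%Z)
        by (unfold q; rewrite plus_IZR, <- INR_IZR_INZ; ring).
      apply Rgt_not_eq, Hq. }
    revert L. apply is_lim_seq_ext. intros n. f_equal. f_equal. rewrite <- HS.
    rewrite <- !INR_IZR_INZ, !Rabs_pos_eq by apply pos_INR.
    replace (Z.of_nat (S n)) with (Z.of_nat n + 1)%Z by lia.
    assert (E : om (Z.of_nat n + 1)%Z = om (Z.of_nat n) * p (Z.of_nat n) / q (Z.of_nat n + 1)%Z).
    { rewrite <- Hrel. field. apply Rgt_not_eq, Hq. }
    rewrite E.
    replace (INR n ^ 2 + (q1 + 2) * INR n + (1 + q1 + q0)) with (q (Z.of_nat n + 1)%Z)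
        by (unfold q; rewrite plus_IZR, <- INR_IZR_INZ; ring).
    replace (INR n ^ 2 + p1 * INR n + p0) with (p (Z.of_nat n)) by (unfold p; rewrite <- INR_IZR_INZ; ring).
    field. repeat split; try first [apply Rgt_not_eq, Hq | apply Rgt_not_eq, Hp | apply Rgt_not_eq, Hom].
    apply pow_nonzero. assert (P := pos_INR n). lra. }
  (* To the left the ratio is q(-n)/p(-n-1), with linear coefficients -q1 and 2-p1. The exponent is
     the same p1-q1-2+k, so one inequality controls both tails. *)
  destruct (raabe (fun i => om (- Z.of_nat i)%Z * (1 + Rabs (IZR (- Z.of_nat i)%Z)) ^ k) (- q1 - (2 - p1) + INR k * 1))
    as [B2 H2].
  { intros n. apply Rmult_lt_0_compat; auto. }
  { lra. }
  { assert (L : ratio_lim (fun n => (INR n ^ 2 + (- q1) * INR n + q0) / (INR n ^ 2 + (2 - p1) * INR n + (1 - p1 + p0))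
        * ((INR n + 2) / (INR n + 1)) ^ k) (- q1 - (2 - p1) + INR k * 1)).
    { apply ratio_lim_mult; [apply ratio_lim_quad|apply ratio_lim_pow, ratio_lim_succ].
      intros n. replace (INR n ^ 2 + (2 - p1) * INR n + (1 - p1 + p0)) with (p (- Z.of_nat n - 1)%Z)
        by (unfold p; rewrite minus_IZR, opp_IZR, <- INR_IZR_INZ; ring).
      apply Rgt_not_eq, Hp. }
    revert L. apply is_lim_seq_ext. intros n. f_equal. f_equal. rewrite <- HS.
    rewrite !opp_IZR, <- !INR_IZR_INZ, !Rabs_Ropp, !Rabs_pos_eq by apply pos_INR.
    replace (- Z.of_nat (S n))%Z with (- Z.of_nat n - 1)%Z by lia.
    assert (E : om (- Z.of_nat n - 1)%Z = om (- Z.of_nat n)%Z * q (- Z.of_nat n)%Z / p (- Z.of_nat n - 1)%Z).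
    { assert (Hr := Hrel (- Z.of_nat n - 1)%Z).
      replace (- Z.of_nat n - 1 + 1)%Z with (- Z.of_nat n)%Z in Hr by lia.
      rewrite Hr. field. apply Rgt_not_eq, Hp. }
    rewrite E.
    replace (INR n ^ 2 + (2 - p1) * INR n + (1 - p1 + p0)) with (p (- Z.of_nat n - 1)%Z)
        by (unfold p; rewrite minus_IZR, opp_IZR, <- INR_IZR_INZ; ring).
    replace (INR n ^ 2 + - q1 * INR n + q0) with (q (- Z.of_nat n)%Z)
        by (unfold q; rewrite opp_IZR, <- INR_IZR_INZ; ring).
    field. repeat split; try first [apply Rgt_not_eq, Hq | apply Rgt_not_eq, Hp | apply Rgt_not_eq, Hom].
    apply pow_nonzero. assert (P := pos_INR n). lra. }
  exists (Rmax B1 B2). intros n. split; (eapply Rle_trans; [|]).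
  - apply H1. - apply Rmax_l. - apply H2. - apply Rmax_r.
Qed.

(** * Sums of products over integer [N]-tuples *)

Definition prodL (b : Z -> R) (l : list Z) : R := fold_right (fun x acc => b x * acc) 1 l.

(** The point 0 is listed twice, which is harmless: the box only serves to bound sums of nonnegative
    terms from above. *)
Definition zbox (L : nat) : list Z :=
  map Z.of_nat (seq 0 (S L)) ++ map (fun i => (- Z.of_nat i)%Z) (seq 0 (S L)).

Fixpoint zgrid (N L : nat) : list (list Z) :=
  match N with
  | O => [[]]
  | S n => flat_map (fun x => map (cons x) (zgrid n L)) (zbox L)
  end.

Lemma in_zbox x L : (Z.abs_nat x <= L)%nat -> In x (zbox L).
Proof.
  intros H. unfold zbox. apply in_or_app. destruct (Z_le_dec 0 x); [left|right];
  apply in_map_iff; exists (Z.abs_nat x); (split; [lia|apply in_seq; lia]).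
Qed.

Lemma in_zgrid l : exists L0, forall L, (L0 <= L)%nat -> In l (zgrid (length l) L).
Proof.
  induction l as [|x l [L0 IH]]; [exists 0%nat; now left|].
  exists (Nat.max (Z.abs_nat x) L0). intros L HL. cbn [length zgrid]. apply in_flat_map. exists x. split.
  - apply in_zbox. lia.
  - apply in_map, IH. lia.
Qed.

Lemma incl_zgrid N F : Forall (fun l => length l = N) F -> exists L, incl F (zgrid N L).
Proof.
  intros H.
  assert (G : exists L0, forall L, (L0 <= L)%nat -> incl F (zgrid N L)).
  { induction H as [|l F Hl HF [L1 IH]]; [exists 0%nat; intros L _ x []|].
    destruct (in_zgrid l) as [L0 H0]. rewrite Hl in H0. exists (Nat.max L0 L1). intros L HL x [<-|Hx].
    - apply H0. lia.
    - apply (IH L); [lia|assumption]. }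
  destruct G as [L0 H0]. exists L0. now apply H0.
Qed.

Lemma sumL_zgrid b N L :
  sumL (zgrid N L) (prodL b) = (fold_right (fun x acc => b x + acc) 0 (zbox L)) ^ N.
Proof.
  induction N as [|N IH]; [cbn; ring|].
  change (zgrid (S N) L) with (flat_map (fun x => map (cons x) (zgrid N L)) (zbox L)).
  cbn [pow]. rewrite <- IH. clear IH. generalize (zgrid N L) as G. intros G.
  induction (zbox L) as [|x l IH]; [cbn; ring|].
  cbn [flat_map fold_right]. rewrite sumL_app, IH, sumL_map.
  rewrite (sumL_ext G _ (fun y => b x * prodL b y)) by reflexivity. rewrite sumL_scal. ring.
Qed.

(** Every finite set of tuples lies in a cube, and over a cube the sum of a product is the [N]-th
    power of a one-variable sum. The two half-lines contribute [B] each. *)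
Lemma product_summable (b : Z -> R) (N : nat) B : (forall x, 0 <= b x) ->
  (forall n, sum_upto (fun i => b (Z.of_nat i)) n <= B /\ sum_upto (fun i => b (- Z.of_nat i)%Z) n <= B) ->
  summable (fun l => length l = N) (prodL b).
Proof.
  intros Hb HB. assert (Hp : forall l, 0 <= prodL b l).
  { induction l; cbn; [lra|]. now apply Rmult_le_pos. }
  exists ((2 * B) ^ N). intros F N1 N2. destruct (incl_zgrid N F N2) as [L HL].
  rewrite (sumL_ext F _ (prodL b)) by (intros; now apply Rabs_pos_eq).
  eapply Rle_trans; [apply (sumL_incl F (zgrid N L)); auto|].
  rewrite sumL_zgrid.
  assert (E : fold_right (fun x acc => b x + acc) 0 (zbox L)
     = sum_upto (fun i => b (Z.of_nat i)) (S L) + sum_upto (fun i => b (- Z.of_nat i)%Z) (S L)).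
  { unfold zbox, sum_upto. generalize (seq 0 (S L)) at 1 3. intros l.
    induction l as [|x l IH]; cbn [map app fold_right].
    - rewrite Rplus_0_l. generalize (seq 0 (S L)). induction l as [|x l IH]; cbn; [reflexivity|]. now rewrite IH.
    - rewrite IH. ring. }
  rewrite E. destruct (HB (S L)). apply pow_incr. split; [|lra].
  assert (G : forall a : nat -> R, (forall i, 0 <= a i) -> forall n, 0 <= sum_upto a n).
  { intros a Ha. induction n; [unfold sum_upto; cbn; lra|]. rewrite sum_upto_S. specialize (Ha n). lra. }
  apply Rplus_le_le_0_compat; apply G; auto.
Qed.

(** * Vandermonde ratios *)

(** The product of (x+d-y)/(x-y) over y in [l]: the factor by which a Vandermonde product changes
    when x moves by d and the points of [l] stay. *)
Fixpoint ratio_at (d : R) (l : list Z) (x : R) : R :=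
  match l with
  | [] => 1
  | y :: l' => (1 + d / (x - IZR y)) * ratio_at d l' x
  end.

(** The sum over x in [l] of g(x) times the product of (x+d-y)/(x-y) over the other points y. The
    recursion pushes the factor of the first point into [g], which keeps induction on the list
    possible. *)
Fixpoint ratio_sum (d : R) (l : list Z) (g : R -> R) : R :=
  match l with
  | [] => 0
  | x :: l' => ratio_at d l' (IZR x) * g (IZR x)
               + ratio_sum d l' (fun t => (1 + d / (t - IZR x)) * g t)
  end.

Lemma ratio_sum_ext d l : forall g h, (forall x, In x l -> g (IZR x) = h (IZR x)) ->
  ratio_sum d l g = ratio_sum d l h.
Proof.
  induction l as [|x l IH]; intros g h H; [reflexivity|]. cbn. f_equal.
  - rewrite H by now left. reflexivity.
  - apply IH. intros t Ht. rewrite H by now right. reflexivity.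
Qed.

Lemma ratio_sum_lin d l : forall g h a b,
  ratio_sum d l (fun t => a * g t + b * h t) = a * ratio_sum d l g + b * ratio_sum d l h.
Proof.
  induction l as [|x l IH]; intros; cbn; [ring|].
  rewrite (ratio_sum_ext d l _ (fun t => a * ((1 + d / (t - IZR x)) * g t) + b * ((1 + d / (t - IZR x)) * h t)))
    by (intros; ring).
  rewrite IH. ring.
Qed.

Lemma ratio_sum_scal d l g a : ratio_sum d l (fun t => a * g t) = a * ratio_sum d l g.
Proof.
  rewrite (ratio_sum_ext d l _ (fun t => a * g t + 0 * g t)) by (intros; ring).
  rewrite ratio_sum_lin. ring.
Qed.

Lemma IZR_minus_neq x y : x <> y -> IZR x - IZR y <> 0.
Proof. intros H E. apply H, eq_IZR. lra. Qed.

(* Partial fractions: [ratio_at d l] tends to 1 at infinity and its residues at the points of [l]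
   are [d] times the weights of [ratio_sum d l]. *)
Lemma ratio_at_partial_fractions d l : NoDup l -> forall y, ~ In y l ->
  ratio_at d l (IZR y) = 1 + d * ratio_sum d l (fun t => / (IZR y - t)).
Proof.
  induction 1 as [|x l Hx Hl IH]; intros y Hy; cbn; [ring|].
  assert (Hyx : y <> x) by (intros ->; apply Hy; now left).
  assert (Hyl : ~ In y l) by (intros H; apply Hy; now right).
  set (c := IZR y - IZR x). assert (Hc : c <> 0) by now apply IZR_minus_neq.
  rewrite (ratio_sum_ext d l _ (fun t => (1 + d / c) * / (IZR y - t) + (- d / c) * / (IZR x - t))).
  - rewrite ratio_sum_lin, (IH y Hyl), (IH x Hx). field. assumption.
  - intros t Ht.
    assert (t <> x) by (intros ->; contradiction). assert (t <> y) by (intros ->; contradiction).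
    assert (IZR t - IZR x <> 0) by now apply IZR_minus_neq.
    assert (IZR y - IZR t <> 0) by now apply IZR_minus_neq, not_eq_sym.
    assert (IZR x - IZR t <> 0) by now apply IZR_minus_neq, not_eq_sym.
    unfold c in *. field. repeat split; assumption.
Qed.

(** The poles that the new point [y] creates cancel against the partial fractions of
    [ratio_at d l y], leaving the divided difference [h] of [g] at [y]. For polynomial [g] the extra
    term has degree one less, so degrees do not grow as points are added. *)
Lemma ratio_sum_cons d l y g h : NoDup (y :: l) ->
  (forall t, In t l -> g (IZR y) - g (IZR t) = (IZR y - IZR t) * h (IZR t)) ->
  ratio_sum d (y :: l) g = g (IZR y) + ratio_sum d l g + d * ratio_sum d l h.
Proof.
  intros Hnd Hh. inversion Hnd as [|? ? Hy Hl]; subst. cbn.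
  rewrite (ratio_at_partial_fractions d l Hl y Hy).
  rewrite (ratio_sum_ext d l (fun t => (1 + d / (t - IZR y)) * g t)
    (fun t => 1 * (1 * g t + d * h t) + (- d * g (IZR y)) * / (IZR y - t))).
  - rewrite (ratio_sum_lin d l (fun t => 1 * g t + d * h t) (fun t => / (IZR y - t))).
    rewrite (ratio_sum_lin d l g h). ring.
  - intros t Ht. assert (t <> y) by (intros ->; contradiction).
    assert (A : IZR t - IZR y <> 0) by now apply IZR_minus_neq.
    assert (B : IZR y - IZR t <> 0) by now apply IZR_minus_neq, not_eq_sym.
    replace (g (IZR y)) with (g (IZR t) + (IZR y - IZR t) * h (IZR t)) by (rewrite <- Hh by assumption; ring).
    field. split; assumption.
Qed.

Definition cube_sum (l : list Z) : R := fold_right (fun x acc => IZR x ^ 3 + acc) 0 l.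

Ltac abs_lra := unfold Rabs in *; repeat destruct Rcase_abs; lra.

(** In degree 3 only the deviation from [cube_sum] is estimated. As [cube_sum] does not involve [d],
    it drops out when the sums for d = 1 and d = -1 are subtracted. *)
Lemma ratio_sum_monomials N : exists K, 0 <= K /\ forall d l r, Rabs d <= 1 ->
  length l = N -> NoDup l -> 1 <= r -> (forall x, In x l -> Rabs (IZR x) <= r) ->
  Rabs (ratio_sum d l (fun _ => 1)) <= K /\
  Rabs (ratio_sum d l (fun t => t)) <= K * r /\
  Rabs (ratio_sum d l (fun t => t ^ 2)) <= K * r ^ 2 /\
  Rabs (ratio_sum d l (fun t => t ^ 3) - cube_sum l) <= K * r ^ 2.
Proof.
  induction N as [|N (K & HK & IH)].
  - exists 0. split; [lra|]. intros d l r _ Hl _ _ _. destruct l; [|discriminate]. cbn.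
    rewrite !Rmult_0_l, Rminus_diag, Rabs_R0. lra.
  (* The degree 3 estimate adds three terms of size K r^2 to the inductive one, hence 4K; the 1 pays
     for the power of the new point in degrees 0 to 2. *)
  - exists (4 * K + 1). split; [lra|]. intros d l r Hd Hl Hnd Hr Hlr.
    destruct l as [|y l]; [discriminate|]. injection Hl as Hl.
    assert (Hnd' : NoDup l) by now inversion Hnd.
    destruct (IH d l r Hd Hl Hnd' Hr (fun x Hx => Hlr x (or_intror Hx))) as (I0 & I1 & I2 & I3).
    assert (Hy := Hlr y (or_introl eq_refl)).
    (* The second function in each line is the divided difference of the monomial, written as nested
       combinations that [ratio_sum_lin] can split. *)
    rewrite (ratio_sum_cons d l y (fun _ => 1) (fun t => 0 * t)) by (assumption || (intros; ring)).
    rewrite (ratio_sum_cons d l y (fun t => t) (fun t => 1)) by (assumption || (intros; ring)).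
    rewrite (ratio_sum_cons d l y (fun t => t ^ 2) (fun t => IZR y * 1 + 1 * t)) by (assumption || (intros; ring)).
    rewrite (ratio_sum_cons d l y (fun t => t ^ 3) (fun t => IZR y * (IZR y * 1 + 1 * t) + 1 * t ^ 2))
      by (assumption || (intros; ring)).
    rewrite !(ratio_sum_lin d l (fun t => IZR y * 1 + 1 * t)), !(ratio_sum_lin d l (fun _ => 1)), ratio_sum_scal.
    cbn [cube_sum fold_right]. fold (cube_sum l).
    set (s0 := ratio_sum d l (fun _ => 1)) in *. set (s1 := ratio_sum d l (fun t => t)) in *.
    set (s2 := ratio_sum d l (fun t => t ^ 2)) in *. set (s3 := ratio_sum d l (fun t => t ^ 3)) in *.
    set (Y := IZR y) in *.
    assert (M : forall a A, Rabs a <= A -> Rabs (d * a) <= A).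
    { intros a A H. rewrite Rabs_mult. assert (P := Rabs_pos d). assert (Q := Rabs_pos a). nra. }
    assert (Pr : r <= r ^ 2) by nra. assert (P0 : 1 <= r ^ 2) by nra.
    assert (KR : K * 1 <= K * r) by (apply Rmult_le_compat_l; lra).
    assert (KR2 : K * r <= K * r ^ 2) by (apply Rmult_le_compat_l; lra).
    assert (Y2 : Rabs (Y ^ 2) <= r ^ 2) by (rewrite <- RPow_abs; apply pow_incr; split; [apply Rabs_pos|assumption]).
    assert (YS0 : Rabs (Y * s0) <= K * r).
    { rewrite Rabs_mult, (Rmult_comm K). apply Rmult_le_compat; try apply Rabs_pos; lra. }
    assert (YS1 : Rabs (Y * s1) <= K * r ^ 2).
    { rewrite Rabs_mult. replace (K * r ^ 2) with (r * (K * r)) by ring.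
      apply Rmult_le_compat; try apply Rabs_pos; lra. }
    assert (YYS0 : Rabs (Y * (Y * s0)) <= K * r ^ 2).
    { rewrite Rabs_mult. replace (K * r ^ 2) with (r * (K * r)) by ring.
      apply Rmult_le_compat; try apply Rabs_pos; lra. }
    assert (D0 := M _ _ I0). assert (D1 := M _ _ I1). assert (D2 := M _ _ I2).
    assert (E0 := M _ _ YS0). assert (E1 := M _ _ YS1). assert (E2 := M _ _ YYS0).
    replace (d * (0 * s1)) with 0 by ring.
    replace (d * (Y * s0 + 1 * s1)) with (d * (Y * s0) + d * s1) by ring.
    replace (d * (Y * (Y * s0 + 1 * s1) + 1 * s2)) with (d * (Y * (Y * s0)) + d * (Y * s1) + d * s2) by ring.
    clear M IH Hlr.
    generalize dependent (d * (Y * (Y * s0))). generalize dependent (d * (Y * s1)). generalize dependent (d * s2).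
    generalize dependent (d * (Y * s0)). generalize dependent (d * s1). generalize dependent (d * s0).
    intros. repeat split.
    + clear - I0 Hr HK. abs_lra.
    + clear - I1 Hy D0 KR Hr HK. abs_lra.
    + clear - Y2 I2 E0 D1 KR KR2 P0 HK. abs_lra.
    + replace (Y ^ 3 + s3 + (r3 + r2 + r1) - (Y ^ 3 + cube_sum l)) with ((s3 - cube_sum l) + (r3 + r2 + r1)) by ring.
      clear - I3 D2 E1 E2 P0 HK. abs_lra.
Qed.

Lemma ratio_abs_le_2 d x y : Rabs d <= 1 -> x <> y -> Rabs (1 + d / (IZR x - IZR y)) <= 2.
Proof.
  intros Hd Hxy. assert (H : 1 <= Rabs (IZR x - IZR y)).
  { rewrite <- minus_IZR, <- abs_IZR. apply IZR_le. lia. }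
  assert (H2 : Rabs (d / (IZR x - IZR y)) <= 1).
  { unfold Rdiv. rewrite Rabs_mult, Rabs_inv.
    apply (Rmult_le_reg_r (Rabs (IZR x - IZR y))); [lra|].
    rewrite Rmult_assoc, Rinv_l by lra. lra. }
  eapply Rle_trans; [apply Rabs_triang|]. rewrite Rabs_R1. lra.
Qed.

Lemma ratio_at_bound d l x : Rabs d <= 1 -> ~ In x l -> Rabs (ratio_at d l (IZR x)) <= 2 ^ length l.
Proof.
  intros Hd Hx. induction l as [|y l IH]; cbn; [rewrite Rabs_R1; lra|].
  rewrite Rabs_mult. apply Rmult_le_compat; try apply Rabs_pos.
  - apply ratio_abs_le_2; [assumption|]. intros ->. apply Hx. now left.
  - apply IH. intros H. apply Hx. now right.
Qed.

(** Distinct integers are at distance at least 1, so each factor is at most 2. This crude bound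
    serves for the second-order remainders, where no cancellation between directions is involved. *)
Lemma ratio_sum_bound d l : Rabs d <= 1 -> NoDup l -> forall g G,
  (forall x, In x l -> Rabs (g (IZR x)) <= G) ->
  Rabs (ratio_sum d l g) <= INR (length l) * 2 ^ length l * G.
Proof.
  intros Hd. induction 1 as [|x l Hx Hl IH]; intros g G HG.
  - cbn. rewrite Rabs_R0. lra.
  - cbn [ratio_sum length]. rewrite S_INR. cbn [pow].
    assert (HF := ratio_at_bound d l x Hd Hx).
    assert (H1 := HG x (or_introl eq_refl)).
    assert (H2 := IH (fun t => (1 + d / (t - IZR x)) * g t) (2 * G)).
    eapply Rle_trans; [apply Rabs_triang|].
    assert (H3 : Rabs (ratio_at d l (IZR x) * g (IZR x)) <= 2 ^ length l * G).
    { rewrite Rabs_mult. apply Rmult_le_compat; try apply Rabs_pos; assumption. }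
    assert (PG : 0 <= G) by (eapply Rle_trans; [apply Rabs_pos|exact H1]).
    assert (PP : 0 < 2 ^ length l) by (apply pow_lt; lra).
    assert (Rabs (ratio_sum d l (fun t => (1 + d / (t - IZR x)) * g t)) <= INR (length l) * 2 ^ length l * (2 * G)).
    { apply H2. intros t Ht. rewrite Rabs_mult. apply Rmult_le_compat; try apply Rabs_pos.
      - apply ratio_abs_le_2; [assumption|]. intros ->. contradiction.
      - apply HG. now right. }
    assert (0 <= 2 ^ length l * G) by (apply Rmult_le_pos; lra).
    lra.
Qed.

(** * The Vandermonde product as a list recursion *)

Fixpoint diff_prod (x : Z) (l : list Z) : R :=
  match l with [] => 1 | y :: l' => IZR (x - y) * diff_prod x l' end.

Fixpoint vdm (l : list Z) : R :=
  match l with [] => 1 | x :: l' => diff_prod x l' * vdm l' end.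

Lemma prodR_map s (f : nat -> R) l : prodR (map s l) f = prodR l (fun i => f (s i)).
Proof. induction l; [reflexivity|]. exact (f_equal _ IHl). Qed.

Lemma prodR_ext l f g : (forall i, In i l -> f i = g i) -> prodR l f = prodR l g.
Proof.
  induction l as [|i l IH]; intros H; cbn; [reflexivity|]. rewrite H by now left. f_equal.
  apply IH. intros j Hj. apply H. now right.
Qed.

Lemma diff_prod_index x l : prodR (seq 0 (length l)) (fun j => IZR (x - ent l j)) = diff_prod x l.
Proof.
  induction l as [|y l IH]; [reflexivity|]. cbn [length seq]. rewrite <- seq_shift.
  change (prodR (0%nat :: map S (seq 0 (length l))) (fun j => IZR (x - ent (y :: l) j)))
    with (IZR (x - y) * prodR (map S (seq 0 (length l))) (fun j => IZR (x - ent (y :: l) j))).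
  rewrite prodR_map. cbn [diff_prod]. f_equal. exact IH.
Qed.

Lemma Vdm_vdm l : Vdm (length l) l = vdm l.
Proof.
  induction l as [|x l IH]; [reflexivity|]. unfold Vdm. cbn [length].
  change (seq 0 (S (length l))) with (0%nat :: seq 1 (length l)). rewrite <- seq_shift.
  match goal with |- prodR (_ :: ?m) ?f = _ => change (prodR (0%nat :: m) f) with (f 0%nat * prodR m f) end.
  cbn [vdm]. f_equal.
  - rewrite <- diff_prod_index. rewrite Nat.sub_succ, Nat.sub_0_r, <- seq_shift, prodR_map. reflexivity.
  - rewrite prodR_map, <- IH. unfold Vdm. apply prodR_ext. intros i Hi.
    rewrite Nat.sub_succ, <- seq_shift, prodR_map. reflexivity.
Qed.

Lemma diff_prod_neq0 x l : ~ In x l -> diff_prod x l <> 0.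
Proof.
  induction l as [|y l IH]; intros H; cbn; [lra|]. apply Rmult_integral_contrapositive. split.
  - rewrite minus_IZR. apply IZR_minus_neq. intros ->. apply H. now left.
  - apply IH. intros H'. apply H. now right.
Qed.

Lemma vdm_neq0 l : NoDup l -> vdm l <> 0.
Proof.
  induction 1 as [|x l Hx Hl IH]; cbn; [lra|]. apply Rmult_integral_contrapositive.
  split; [now apply diff_prod_neq0|assumption].
Qed.

Lemma length_addk k d l : length (addk k d l) = length l.
Proof. revert k. induction l as [|x l IH]; intros [|k]; cbn; auto. Qed.

Lemma addk_addk k d e l : addk k d (addk k e l) = addk k (e + d) l.
Proof.
  revert k. induction l as [|x l IH]; intros [|k]; cbn; auto; f_equal; auto. lia.
Qed.

Lemma addk_0 k l : addk k 0 l = l.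
Proof. revert k. induction l as [|x l IH]; intros [|k]; cbn; auto; f_equal; auto. lia. Qed.

Lemma ent_addk k d l : (k < length l)%nat -> ent (addk k d l) k = (ent l k + d)%Z.
Proof.
  revert k. induction l as [|x l IH]; intros [|k] H; cbn in *; try lia. apply IH. lia.
Qed.

Lemma ratio_at_diff_prod d x l : ~ In x l ->
  diff_prod (x + d) l / diff_prod x l = ratio_at (IZR d) l (IZR x).
Proof.
  induction l as [|y l IH]; intros H; cbn; [field|].
  assert (H1 : ~ In x l) by (intros H'; apply H; now right).
  assert (H2 : IZR x - IZR y <> 0) by (apply IZR_minus_neq; intros ->; apply H; now left).
  rewrite <- IH by assumption. assert (H3 := diff_prod_neq0 x l H1).
  rewrite !minus_IZR, plus_IZR. field. split; assumption.
Qed.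

Lemma diff_prod_addk k d x l : ~ In x l -> (k < length l)%nat ->
  diff_prod x (addk k d l) = diff_prod x l * (1 + IZR d / (IZR (ent l k) - IZR x)).
Proof.
  revert k. induction l as [|y l IH]; intros k H Hk; [cbn in Hk; lia|].
  assert (H1 : ~ In x l) by (intros H'; apply H; now right).
  assert (H2 : IZR y - IZR x <> 0) by (apply IZR_minus_neq; intros ->; apply H; now left).
  destruct k as [|k]; cbn [addk diff_prod].
  - change (ent (y :: l) 0) with y. rewrite !minus_IZR, plus_IZR. field. assumption.
  - rewrite IH by (assumption || (cbn in Hk; lia)). change (ent (y :: l) (S k)) with (ent l k). ring.
Qed.

Lemma sumN_ext l f g : (forall i, In i l -> f i = g i) -> sumN l f = sumN l g.
Proof.
  induction l as [|i l IH]; intros H; cbn; [reflexivity|]. rewrite H by now left. f_equal.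
  apply IH. intros j Hj. apply H. now right.
Qed.

Lemma sumN_plus l f g : sumN l (fun i => f i + g i) = sumN l f + sumN l g.
Proof.
  induction l as [|i l IH]; [cbn; ring|].
  change (f i + g i + sumN l (fun i => f i + g i) = f i + sumN l f + (g i + sumN l g)). rewrite IH. ring.
Qed.

Lemma sumN_map s (f : nat -> R) l : sumN (map s l) f = sumN l (fun i => f (s i)).
Proof. induction l; [reflexivity|]. exact (f_equal _ IHl). Qed.

(** Moving an entry t of the tail multiplies the head's [diff_prod] by 1 + d/(t-x), which is the
    very factor that [ratio_sum] pushes into [g]. *)
Lemma vdm_ratio_sum d l : NoDup l -> forall g,
  sumN (seq 0 (length l)) (fun k => vdm (addk k d l) / vdm l * g (IZR (ent l k))) = ratio_sum (IZR d) l g.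
Proof.
  induction 1 as [|x l Hx Hl IH]; intros g; [reflexivity|].
  cbn [length]. change (seq 0 (S (length l))) with (0%nat :: seq 1 (length l)). rewrite <- seq_shift.
  match goal with |- sumN (_ :: ?m) ?f = _ => change (sumN (0%nat :: m) f) with (f 0%nat + sumN m f) end.
  cbn [ratio_sum]. assert (H1 := diff_prod_neq0 x l Hx). assert (H2 := vdm_neq0 l Hl). f_equal.
  - cbn [addk vdm]. rewrite <- ratio_at_diff_prod by assumption.
    change (ent (x :: l) 0) with x. field. split; assumption.
  - rewrite sumN_map, <- IH. apply sumN_ext. intros k Hk. apply in_seq in Hk.
    cbn [addk vdm]. rewrite diff_prod_addk by (assumption || lia).
    change (ent (x :: l) (S k)) with (ent l k). field. repeat split; try assumption.
    apply IZR_minus_neq. intros <-. apply Hx. apply nth_In. lia.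
Qed.

(** * The generator and its Lyapunov function *)

Lemma inOmega_NoDup N l : inOmega N l -> NoDup l.
Proof.
  intros [_ H]. apply Sorted_StronglySorted in H; [|intros a b c; lia].
  induction H as [|x l Hl IH HF]; constructor; [|assumption].
  intros Hx. rewrite List.Forall_forall in HF. specialize (HF x Hx). lia.
Qed.

Lemma diff_prod_in x l : In x l -> diff_prod x l = 0.
Proof.
  induction l as [|y l IH]; intros H; [destruct H|]. destruct H as [->|H]; cbn.
  - rewrite Z.sub_diag. ring.
  - rewrite IH by assumption. ring.
Qed.

Lemma Sorted_addk k d l : (-1 <= d <= 1)%Z -> Sorted (fun a b => (a > b)%Z) l ->
  Sorted (fun a b => (a >= b)%Z) (addk k d l).
Proof.
  intros Hd H. revert k.
  assert (W : forall l, Sorted (fun a b => (a > b)%Z) l -> Sorted (fun a b => (a >= b)%Z) l).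
  { induction 1 as [|x m Hm IH Hx]; constructor; [assumption|]. inversion Hx; constructor; lia. }
  induction H as [|x m Hm IH Hx]; intros k; [destruct k; constructor|].
  destruct k as [|k]; cbn; constructor.
  - now apply W.
  - inversion Hx; constructor; lia.
  - apply IH.
  - destruct m as [|y m]; [destruct k; constructor|]. inversion Hx; subst. destruct k; cbn; constructor; lia.
Qed.

Lemma Sorted_vdm l : Sorted (fun a b => (a >= b)%Z) l -> vdm l <> 0 -> Sorted (fun a b => (a > b)%Z) l.
Proof.
  induction 1 as [|x m Hm IH Hx]; intros H; constructor.
  - apply IH. intros E. apply H. cbn. rewrite E. ring.
  - destruct m as [|y m]; constructor. inversion Hx; subst.
    assert (x <> y); [|lia]. intros ->. apply H. cbn [vdm]. rewrite diff_prod_in by now left. ring.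
Qed.

(** A unit move keeps the weak order, so leaving Omega means that two coordinates collide. Jumps out
    of Omega therefore have rate 0. *)
Lemma vdm_addk_boundary N k d l : (-1 <= d <= 1)%Z -> inOmega N l -> ~ inOmega N (addk k d l) ->
  vdm (addk k d l) = 0.
Proof.
  intros Hd [Hl Hs] Hn. apply NNPP. intros H. apply Hn. split; [now rewrite length_addk|].
  apply Sorted_vdm; [|assumption]. now apply Sorted_addk.
Qed.

Lemma vdm_ratio_bound d l : (-1 <= d <= 1)%Z -> NoDup l -> forall k, (k < length l)%nat ->
  Rabs (vdm (addk k d l) / vdm l) <= 2 ^ length l.
Proof.
  intros Hd.
  assert (Hd' : Rabs (IZR d) <= 1) by (rewrite <- abs_IZR; apply IZR_le; lia).
  induction 1 as [|x l Hx Hl IH]; intros k Hk; [cbn in Hk; lia|].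
  assert (H1 := diff_prod_neq0 x l Hx). assert (H2 := vdm_neq0 l Hl). cbn [length pow].
  destruct k as [|k]; cbn [addk vdm].
  - replace (diff_prod (x + d) l * vdm l / (diff_prod x l * vdm l))
      with (diff_prod (x + d) l / diff_prod x l) by (field; split; assumption).
    rewrite ratio_at_diff_prod by assumption.
    assert (HF := ratio_at_bound (IZR d) l x Hd' Hx).
    assert (0 < 2 ^ length l) by (apply pow_lt; lra). lra.
  - cbn in Hk. rewrite diff_prod_addk by (assumption || lia).
    assert (Hne : ent l k <> x) by (intros <-; apply Hx, nth_In; lia).
    replace (diff_prod x l * (1 + IZR d / (IZR (ent l k) - IZR x)) * vdm (addk k d l) / (diff_prod x l * vdm l))
      with ((1 + IZR d / (IZR (ent l k) - IZR x)) * (vdm (addk k d l) / vdm l))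
      by (field; repeat split; try assumption; now apply IZR_minus_neq).
    rewrite Rabs_mult. apply Rmult_le_compat; try apply Rabs_pos.
    + now apply ratio_abs_le_2.
    + apply IH. lia.
Qed.

Definition phi (l : list Z) : R := 1 + fold_right (fun x acc => IZR x ^ 2 + acc) 0 l.

Lemma phi_cons x l : phi (x :: l) = IZR x ^ 2 + phi l.
Proof. unfold phi. cbn. ring. Qed.

Lemma phi_ge_1 l : 1 <= phi l.
Proof.
  induction l as [|x l IH]; [unfold phi; cbn; lra|]. rewrite phi_cons.
  assert (P := pow2_ge_0 (IZR x)). lra.
Qed.

Lemma phi_in x l : In x l -> 1 + IZR x ^ 2 <= phi l.
Proof.
  induction l as [|y l IH]; intros H; [destruct H|]. destruct H as [<-|H]; rewrite phi_cons.
  - assert (P := phi_ge_1 l). lra.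
  - specialize (IH H). assert (P := pow2_ge_0 (IZR y)). lra.
Qed.

Lemma phi_addk k d l : (k < length l)%nat ->
  phi (addk k d l) = phi l + 2 * IZR d * IZR (ent l k) + IZR d ^ 2.
Proof.
  revert k. induction l as [|x l IH]; intros k Hk; [cbn in Hk; lia|].
  destruct k as [|k]; cbn [addk]; rewrite !phi_cons.
  - change (ent (x :: l) 0) with x. rewrite plus_IZR. ring.
  - rewrite IH by (cbn in Hk; lia). change (ent (x :: l) (S k)) with (ent l k). ring.
Qed.

Definition psi (T : R) (l : list Z) : R := T / (T + phi l).

(** Both jump rates are monic quadratics. The common leading coefficient yields the cubic
    cancellation, and the linear coefficients determine the Raabe exponent. *)
Definition quad (a b x : R) : R := x ^ 2 + a * x + b.

Lemma quad_bound a b x F : 1 + x ^ 2 <= F -> Rabs (quad a b x) <= (1 + Rabs a + Rabs b) * F.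
Proof.
  intros H. unfold quad. assert (P := pow2_ge_0 x).
  assert (Hx : Rabs x <= F).
  { assert (Q := Rabs_pos x). rewrite <- (pow2_abs x) in *. nra. }
  assert (Pa := Rabs_pos a). assert (Pb := Rabs_pos b).
  eapply Rle_trans; [apply Rabs_triang|]. rewrite !Rmult_plus_distr_r. apply Rplus_le_compat.
  - eapply Rle_trans; [apply Rabs_triang|]. apply Rplus_le_compat.
    + rewrite Rabs_pos_eq by assumption. lra.
    + rewrite Rabs_mult. apply Rmult_le_compat_l; lra.
  - rewrite <- (Rmult_1_r (Rabs b)) at 1. apply Rmult_le_compat_l; lra.
Qed.

Section Chain.

Variables (p1 p0 q1 q0 : R) (N : nat).

Definition gen (f : list Z -> R) (l : list Z) : R :=
  sumN (seq 0 N) (fun k =>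
    vdm (addk k 1 l) / vdm l * quad p1 p0 (IZR (ent l k)) * (f (addk k 1 l) - f l)
    + vdm (addk k (-1) l) / vdm l * quad q1 q0 (IZR (ent l k)) * (f (addk k (-1) l) - f l)).

(* The cubic terms [2 x^3] and [- 2 x^3] cancel up to a quadratic error. *)
Lemma drift_bound : exists K, 0 <= K /\ forall l, length l = N -> NoDup l ->
  Rabs (ratio_sum 1 l (fun x => quad p1 p0 x * (2 * x + 1)) +
        ratio_sum (-1) l (fun x => quad q1 q0 x * (- 2 * x + 1))) <= K * phi l.
Proof.
  destruct (ratio_sum_monomials N) as (K & HK & H).
  (* The 4 is 2 + 2, from the errors of the two cubic sums; the rest are the lower coefficients of
     [quad p1 p0 x * (2 * x + 1)] and its backward counterpart. *)
  set (A := 4 + (Rabs (1 + 2 * p1) + Rabs (p1 + 2 * p0) + Rabs p0)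
     + (Rabs (1 - 2 * q1) + Rabs (q1 - 2 * q0) + Rabs q0)).
  exists (A * K). split.
  { apply Rmult_le_pos; [|assumption]. unfold A. repeat apply Rplus_le_le_0_compat; try apply Rabs_pos. lra. }
  intros l Hl Hnd. set (r := sqrt (phi l)). assert (P := phi_ge_1 l).
  assert (Hr2 : r ^ 2 = phi l) by (apply pow2_sqrt; lra).
  assert (Hr : 1 <= r) by (rewrite <- sqrt_1; apply sqrt_le_1_alt; lra).
  assert (Hin : forall x, In x l -> Rabs (IZR x) <= r).
  { intros x Hx. apply Rsqr_incr_0; try apply Rabs_pos; try lra. rewrite <- Rsqr_abs.
    assert (Q := phi_in x l Hx). unfold Rsqr. nra. }
  destruct (H 1 l r ltac:(abs_lra) Hl Hnd Hr Hin) as (A0 & A1 & A2 & A3).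
  destruct (H (-1) l r ltac:(abs_lra) Hl Hnd Hr Hin) as (B0 & B1 & B2 & B3).
  rewrite (ratio_sum_ext 1 l _ (fun x => 1 * (2 * x ^ 3 + (1 + 2 * p1) * x ^ 2) + 1 * ((p1 + 2 * p0) * x + p0 * 1)))
    by (intros; unfold quad; ring).
  rewrite (ratio_sum_ext (-1) l _ (fun x => 1 * (-2 * x ^ 3 + (1 - 2 * q1) * x ^ 2) + 1 * ((q1 - 2 * q0) * x + q0 * 1)))
    by (intros; unfold quad; ring).
  rewrite !(ratio_sum_lin _ _ (fun x => _ * x ^ 3 + _ * x ^ 2)), !(ratio_sum_lin _ _ (fun x => x ^ 3)),
    !(ratio_sum_lin _ _ (fun x => x)).
  rewrite <- Hr2.
  assert (KR : K * 1 <= K * r) by (apply Rmult_le_compat_l; lra).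
  assert (KR2 : K * r <= K * r ^ 2) by (apply Rmult_le_compat_l; nra).
  set (Q := K * r ^ 2) in *.
  assert (M : forall c a, Rabs a <= Q -> Rabs (c * a) <= Rabs c * Q).
  { intros c a Ha. rewrite Rabs_mult. apply Rmult_le_compat_l; [apply Rabs_pos|assumption]. }
  replace (A * K * r ^ 2) with (A * Q) by (unfold Q; ring).
  assert (T1 := M (1 + 2 * p1) _ A2). assert (T2 := M (1 - 2 * q1) _ B2).
  assert (T3 := M (p1 + 2 * p0) (ratio_sum 1 l (fun x => x)) ltac:(lra)). assert (T4 := M (q1 - 2 * q0) (ratio_sum (-1) l (fun x => x)) ltac:(lra)).
  assert (T5 := M p0 (ratio_sum 1 l (fun _ => 1)) ltac:(lra)).
  assert (T6 := M q0 (ratio_sum (-1) l (fun _ => 1)) ltac:(lra)).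
  clear - A3 B3 T1 T2 T3 T4 T5 T6 KR KR2. fold Q in A3, B3.
  unfold A. rewrite Rabs_le_between in *. clear A. lra.
Qed.

(** A jump changes [phi] by 2 d n_k + 1, so for a function of [phi] the new value depends only on
    the product d n_k, and one [h] covers both directions. *)
Lemma gen_ratio_sum (h : R -> R) f l : length l = N -> NoDup l ->
  (forall k d, (k < N)%nat -> (d = 1 \/ d = -1)%Z -> f (addk k d l) = h (IZR d * IZR (ent l k))) ->
  gen f l = ratio_sum 1 l (fun x => quad p1 p0 x * (h x - f l))
          + ratio_sum (-1) l (fun x => quad q1 q0 x * (h (- x) - f l)).
Proof.
  intros Hl Hnd Hf. unfold gen. rewrite sumN_plus, <- Hl.
  rewrite <- (vdm_ratio_sum 1 l Hnd), <- (vdm_ratio_sum (-1) l Hnd).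
  f_equal; apply sumN_ext; intros k Hk; apply in_seq in Hk; rewrite Hf by (auto; lia).
  - rewrite Rmult_1_l. ring.
  - replace (-1 * IZR (ent l k)) with (- IZR (ent l k)) by ring. ring.
Qed.

(* [v] is the value of [phi] at the forward neighbour of a point where [phi = F]; backward jumps
   correspond to [- x]. *)
Lemma second_order_bound a b T F x v : 0 < T -> 1 + x ^ 2 <= F -> v = F + 2 * x + 1 ->
  0 < v /\ Rabs (quad a b x * (T * (2 * x + 1) ^ 2 / ((T + F) ^ 2 * (T + v))))
    <= 24 * (1 + Rabs a + Rabs b) * (F / (T + F)).
Proof.
  intros HT HF Hv.
  (* Neighbouring values of [phi] are comparable: 3v - F >= 2(x+3/2)^2. This 3, times the 8 in
     (2x+1)^2 <= 8F, gives the constant 24. *)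
  assert (H3 : F <= 3 * v) by (assert (Q := pow2_ge_0 (x + 3 / 2)); nra). assert (PF : 1 <= F) by nra.
  split; [lra|]. rewrite Rabs_mult. assert (Hq := quad_bound a b x F HF).
  set (A := 1 + Rabs a + Rabs b) in *.
  assert (HA : 1 <= A) by (unfold A; assert (Pa := Rabs_pos a); assert (Pb := Rabs_pos b); lra).
  assert (Hs : (2 * x + 1) ^ 2 <= 8 * F) by nra.
  assert (P : 0 < (T + F) ^ 2 * (T + v)) by (apply Rmult_lt_0_compat; [apply pow_lt|]; lra).
  rewrite (Rabs_pos_eq (T * (2 * x + 1) ^ 2 / ((T + F) ^ 2 * (T + v)))).
  2:{ apply Rle_mult_inv_pos; [|assumption]. apply Rmult_le_pos; [lra|apply pow2_ge_0]. }
  apply Rle_trans with (A * F * (T * (8 * F) / ((T + F) ^ 2 * (T + v)))).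
  { apply Rmult_le_compat; try apply Rabs_pos; try assumption.
    - apply Rle_mult_inv_pos; [|assumption]. apply Rmult_le_pos; [lra|apply pow2_ge_0].
    - apply Rmult_le_compat_r; [left; now apply Rinv_0_lt_compat|]. apply Rmult_le_compat_l; lra. }
  replace (A * F * (T * (8 * F) / ((T + F) ^ 2 * (T + v))))
    with (A * F / (T + F) * (8 * (T * F) / ((T + F) * (T + v)))) by (field; lra).
  replace (24 * A * (F / (T + F))) with (A * F / (T + F) * 24) by (field; lra).
  apply Rmult_le_compat_l.
  { apply Rle_mult_inv_pos; [apply Rmult_le_pos|]; lra. }
  apply (Rmult_le_reg_r ((T + F) * (T + v))); [apply Rmult_lt_0_compat; lra|].
  unfold Rdiv at 1. rewrite Rmult_assoc, Rinv_l, Rmult_1_r by (apply Rgt_not_eq, Rmult_lt_0_compat; lra).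
  assert (0 < T * F) by (apply Rmult_lt_0_compat; lra).
  assert (T * F <= T * (3 * v)) by (apply Rmult_le_compat_l; lra).
  assert (0 <= F * v) by (apply Rmult_le_pos; lra). nra.
Qed.

(** Exact Taylor expansion in [phi]: T/(T+v) - T/(T+F) = -k(v-F) + T(v-F)^2/((T+F)^2(T+v)) with k =
    T/(T+F)^2. The linear part is -k times the drift of [phi], where the cancellation is used; the
    remainder is already of the right size term by term. *)
Lemma psi_gen_bound : exists K, 0 <= K /\ forall T l, 0 < T -> inOmega N l ->
  Rabs (gen (psi T) l) <= K * (phi l / (T + phi l)).
Proof.
  destruct drift_bound as (K & HK & Hdrift).
  set (c := INR N * 2 ^ N).
  assert (Hc : 0 <= c) by (apply Rmult_le_pos; [apply pos_INR|left; apply pow_lt; lra]).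
  set (K1 := 24 * (1 + Rabs p1 + Rabs p0)). set (K2 := 24 * (1 + Rabs q1 + Rabs q0)).
  exists (K + c * K1 + c * K2). split.
  { assert (P1 := Rabs_pos p1). assert (P2 := Rabs_pos p0). assert (P3 := Rabs_pos q1). assert (P4 := Rabs_pos q0).
    repeat apply Rplus_le_le_0_compat; try assumption; apply Rmult_le_pos; unfold K1, K2; lra. }
  intros T l HT HO. assert (Hnd := inOmega_NoDup N l HO). assert (Hl := proj1 HO).
  set (F := phi l). assert (PF : 1 <= F) by apply phi_ge_1.
  rewrite (gen_ratio_sum (fun y => T / (T + (F + 2 * y + 1)))); try assumption.
  2:{ intros k d Hk Hd. unfold psi. rewrite phi_addk by lia. fold F. f_equal.
      destruct Hd as [-> | ->]; ring. }
  unfold psi. fold F.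
  assert (Hx : forall x, In x l -> 1 + IZR x ^ 2 <= F) by (intros; now apply phi_in).
  set (k := T / (T + F) ^ 2).
  rewrite (ratio_sum_ext 1 l _ (fun x => (- k) * (quad p1 p0 x * (2 * x + 1))
      + 1 * (quad p1 p0 x * (T * (2 * x + 1) ^ 2 / ((T + F) ^ 2 * (T + (F + 2 * x + 1))))))).
  2:{ intros x Hxl. destruct (second_order_bound p1 p0 T F (IZR x) _ HT (Hx x Hxl) eq_refl) as [Hv _].
      unfold k. field. split; lra. }
  rewrite (ratio_sum_ext (-1) l _ (fun x => (- k) * (quad q1 q0 x * (- 2 * x + 1))
      + 1 * (quad q1 q0 x * (T * (- 2 * x + 1) ^ 2 / ((T + F) ^ 2 * (T + (F + 2 * - x + 1))))))).
  2:{ intros x Hxl. destruct (second_order_bound q1 q0 T F (- IZR x) (F + 2 * - IZR x + 1) HT) as [Hv _];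
      [rewrite <- Rsqr_pow2, <- Rsqr_neg, Rsqr_pow2; now apply Hx|reflexivity|].
      unfold k. field. split; lra. }
  rewrite !(ratio_sum_lin _ _ (fun x => quad _ _ x * (_ * x + 1))).
  assert (B1 : Rabs (ratio_sum 1 l (fun x => quad p1 p0 x * (T * (2 * x + 1) ^ 2 / ((T + F) ^ 2 * (T + (F + 2 * x + 1))))))
     <= c * (K1 * (F / (T + F)))).
  { unfold c. rewrite <- Hl. apply ratio_sum_bound; [abs_lra|assumption|]. intros x Hxl.
    now apply (second_order_bound p1 p0 T F (IZR x) _ HT (Hx x Hxl) eq_refl). }
  assert (B2 : Rabs (ratio_sum (-1) l (fun x => quad q1 q0 x * (T * (-2 * x + 1) ^ 2 / ((T + F) ^ 2 * (T + (F + 2 * - x + 1))))))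
     <= c * (K2 * (F / (T + F)))).
  { unfold c. rewrite <- Hl. apply ratio_sum_bound; [abs_lra|assumption|]. intros x Hxl.
    destruct (second_order_bound (- q1) q0 T F (- IZR x) (F + 2 * - IZR x + 1) HT) as [_ Hb];
      [rewrite <- Rsqr_pow2, <- Rsqr_neg, Rsqr_pow2; now apply Hx|reflexivity|].
    rewrite Rabs_Ropp in Hb. fold K2 in Hb.
    replace (quad q1 q0 (IZR x)) with (quad (- q1) q0 (- IZR x)) by (unfold quad; ring).
    replace (-2 * IZR x + 1) with (2 * - IZR x + 1) by ring. exact Hb. }
  assert (B0 := Hdrift l Hl Hnd). fold F in B0.
  assert (Hk : k * F <= F / (T + F)).
  { unfold k. replace (T / (T + F) ^ 2 * F) with (T / (T + F) * (F / (T + F))) by (field; lra).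
    rewrite <- (Rmult_1_l (F / (T + F))) at 2. apply Rmult_le_compat_r.
    - apply Rle_mult_inv_pos; lra.
    - apply (Rmult_le_reg_r (T + F)); [lra|]. unfold Rdiv. rewrite Rmult_assoc, Rinv_l by lra. lra. }
  assert (Pk : 0 <= k) by (apply Rle_mult_inv_pos; [lra|apply pow_lt; lra]).
  match goal with |- Rabs (- k * ?a + 1 * ?b + (- k * ?a' + 1 * ?b')) <= _ =>
    replace (- k * a + 1 * b + (- k * a' + 1 * b')) with (- (k * (a + a')) + b + b') by ring end.
  eapply Rle_trans; [apply Rabs_triang|]. rewrite !Rmult_plus_distr_r, !Rmult_assoc.
  apply Rplus_le_compat; [|exact B2].
  eapply Rle_trans; [apply Rabs_triang|]. apply Rplus_le_compat; [|exact B1].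
  rewrite Rabs_Ropp, Rabs_mult, Rabs_pos_eq by assumption.
  apply Rle_trans with (k * (K * F)); [now apply Rmult_le_compat_l|].
  replace (k * (K * F)) with (K * (k * F)) by ring. now apply Rmult_le_compat_l.
Qed.

End Chain.

(** * Detailed balance *)

Lemma prodL_cons a x l : prodL a (x :: l) = a x * prodL a l.
Proof. reflexivity. Qed.

Lemma prodL_mult a b l : prodL (fun x => a x * b x) l = prodL a l * prodL b l.
Proof. induction l as [|x l IH]; [cbn; ring|]. rewrite !prodL_cons, IH. ring. Qed.

Lemma prodL_pow a k l : prodL (fun x => a x ^ k) l = prodL a l ^ k.
Proof.
  induction l as [|x l IH]; [symmetry; apply pow1|]. rewrite !prodL_cons, IH. symmetry. apply Rpow_mult_distr.
Qed.

Lemma prodL_pos a l : (forall x, 0 < a x) -> 0 < prodL a l.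
Proof. intros H. induction l as [|x l IH]; [cbn; lra|]. rewrite prodL_cons. now apply Rmult_lt_0_compat. Qed.

Lemma one_plus_abs_pos x : 0 < 1 + Rabs (IZR x).
Proof. assert (P := Rabs_pos (IZR x)). lra. Qed.

Lemma diff_prod_bound x l :
  Rabs (diff_prod x l) <= (1 + Rabs (IZR x)) ^ length l * prodL (fun y => 1 + Rabs (IZR y)) l.
Proof.
  induction l as [|y l IH]; [cbn; rewrite Rabs_R1; lra|].
  cbn [diff_prod length pow]. rewrite prodL_cons, Rabs_mult.
  replace ((1 + Rabs (IZR x)) * (1 + Rabs (IZR x)) ^ length l *
     ((1 + Rabs (IZR y)) * prodL (fun y => 1 + Rabs (IZR y)) l))
    with (((1 + Rabs (IZR x)) * (1 + Rabs (IZR y))) *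
     ((1 + Rabs (IZR x)) ^ length l * prodL (fun y => 1 + Rabs (IZR y)) l)) by ring.
  apply Rmult_le_compat; try apply Rabs_pos; [|assumption].
  rewrite minus_IZR. unfold Rminus. eapply Rle_trans; [apply Rabs_triang|]. rewrite Rabs_Ropp.
  assert (P := Rabs_pos (IZR x)). assert (Q := Rabs_pos (IZR y)). nra.
Qed.

(** Each difference satisfies |x-y| <= (1+|x|)(1+|y|), and each coordinate occurs in one pair with
    every other one, hence the exponent. *)
Lemma vdm_bound l : Rabs (vdm l) <= prodL (fun y => 1 + Rabs (IZR y)) l ^ pred (length l).
Proof.
  induction l as [|x l IH]; [cbn; rewrite Rabs_R1; lra|]. cbn [vdm length pred].
  change (prodL (fun y => 1 + Rabs (IZR y)) (x :: l))
    with ((1 + Rabs (IZR x)) * prodL (fun y => 1 + Rabs (IZR y)) l).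
  rewrite Rpow_mult_distr, Rabs_mult. assert (D := diff_prod_bound x l).
  assert (W := prodL_pos _ l one_plus_abs_pos). set (w := prodL (fun y => 1 + Rabs (IZR y)) l) in *.
  apply Rle_trans with ((1 + Rabs (IZR x)) ^ length l * w * w ^ pred (length l)).
  - apply Rmult_le_compat; try apply Rabs_pos; assumption.
  - rewrite Rmult_assoc. apply Rmult_le_compat_l; [left; apply pow_lt, one_plus_abs_pos|].
    destruct l as [|y l]; cbn; [|lra]. unfold w. cbn. lra.
Qed.

Lemma has_sum_sumN Dm l (g : nat -> list Z -> R) : (forall k, In k l -> has_sum Dm (g k) 0) ->
  has_sum Dm (fun x => sumN l (fun k => g k x)) 0.
Proof.
  induction l as [|k l IH]; intros H; [apply has_sum_zero|].
  replace 0 with (1 * 0 + 1 * 0) by ring.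
  apply (has_sum_ext _ (fun x => 1 * g k x + 1 * sumN l (fun j => g j x))).
  - intros x _. rewrite !Rmult_1_l. reflexivity.
  - apply has_sum_lin; [apply H; now left|apply IH; intros j Hj; apply H; now right].
Qed.

Lemma sumN_scal l f c : sumN l (fun i => c * f i) = c * sumN l f.
Proof.
  induction l as [|i l IH]; [cbn; ring|].
  change (c * f i + sumN l (fun i => c * f i) = c * (f i + sumN l f)). rewrite IH. ring.
Qed.

Lemma C0_bounded Dm f : C0 Dm f -> exists B, 0 <= B /\ forall x, Dm x -> Rabs (f x) <= B.
Proof.
  intros H. destruct (H 1 ltac:(lra)) as [F HF].
  exists (1 + sumL F (fun x => Rabs (f x))).
  assert (P : forall G, 0 <= sumL G (fun x => Rabs (f x))) by (intros; apply sumL_nonneg; intros; apply Rabs_pos).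
  split; [specialize (P F); lra|].
  intros x Hx. destruct (in_dec lZ_dec x F) as [Hi|Hi].
  - destruct (in_split x F Hi) as (F1 & F2 & ->). rewrite sumL_app, sumL_cons.
    assert (P1 := P F1). assert (P2 := P F2). lra.
  - specialize (HF x Hx Hi). specialize (P F). lra.
Qed.

Lemma C0_abs_lin Dm f g K : 0 <= K -> C0 Dm f -> C0 Dm g -> C0 Dm (fun x => Rabs (g x) + K * Rabs (f x)).
Proof.
  intros HK Hf Hg eps He.
  destruct (Hg (eps / 2) ltac:(lra)) as [F1 H1].
  destruct (Hf (eps / (2 * (K + 1)))) as [F2 H2]; [apply Rdiv_lt_0_compat; lra|].
  exists (F1 ++ F2). intros x Hx Hn.
  specialize (H1 x Hx (fun H => Hn (in_or_app _ _ _ (or_introl H)))).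
  specialize (H2 x Hx (fun H => Hn (in_or_app _ _ _ (or_intror H)))).
  assert (P1 := Rabs_pos (f x)). assert (P2 := Rabs_pos (g x)).
  rewrite Rabs_pos_eq by nra.
  apply (Rmult_lt_compat_r (2 * (K + 1))) in H2; [|lra].
  unfold Rdiv in H2. rewrite Rmult_assoc, Rinv_l in H2 by lra. lra.
Qed.

Section Weights.

Variables (p1 p0 q1 q0 : R) (om : Z -> R) (N : nat).
Hypothesis om_pos : forall x, 0 < om x.
Hypothesis om_ratio : forall x, om (x + 1)%Z * quad q1 q0 (IZR (x + 1)) = om x * quad p1 p0 (IZR x).

(** Extended by 0, the weight can be summed over all lists of length [N], on which [addk k 1] is a
    bijection, as it is not on Omega. Summation by parts becomes a reindexing without boundary
    terms. *)
Definition weight (l : list Z) : R :=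
  if excluded_middle_informative (inOmega N l) then vdm l ^ 2 * prodL om l else 0.

Lemma weight_in l : inOmega N l -> weight l = vdm l ^ 2 * prodL om l.
Proof. intros H. unfold weight. now destruct excluded_middle_informative. Qed.

Lemma weight_out l : ~ inOmega N l -> weight l = 0.
Proof. intros H. unfold weight. now destruct excluded_middle_informative. Qed.

Lemma weight_summable : (forall x, 0 < quad p1 p0 (IZR x)) -> (forall x, 0 < quad q1 q0 (IZR x)) ->
  p1 - q1 - 2 + INR (2 * pred N) < -1 -> summable (fun l => length l = N) weight.
Proof.
  intros Hp Hq HA.
  destruct (one_particle_summable om p1 p0 q1 q0 (2 * pred N) Hp Hq om_pos om_ratio HA) as [B HB].
  apply (summable_dom _ _ (prodL (fun x => om x * (1 + Rabs (IZR x)) ^ (2 * pred N))) 1); [|lra|].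
  - apply product_summable with B; [|exact HB]. intros x. left.
    apply Rmult_lt_0_compat; [apply om_pos|apply pow_lt, one_plus_abs_pos].
  - intros l Hl. rewrite Rmult_1_l.
    assert (Pw : 0 < prodL om l) by now apply prodL_pos.
    rewrite prodL_mult, prodL_pow. assert (PW := prodL_pos _ l one_plus_abs_pos).
    rewrite (Rabs_pos_eq (prodL om l * _)) by (left; apply Rmult_lt_0_compat; [assumption|now apply pow_lt]).
    unfold weight. destruct excluded_middle_informative.
    + rewrite Rabs_mult, (Rabs_pos_eq (prodL om l)), Rmult_comm by lra.
      apply Rmult_le_compat_l; [lra|]. rewrite <- RPow_abs, Nat.mul_comm, pow_mult.
      apply pow_incr. split; [apply Rabs_pos|]. rewrite <- Hl. apply vdm_bound.
    + rewrite Rabs_R0. left. apply Rmult_lt_0_compat; [assumption|now apply pow_lt].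
Qed.

Lemma prodL_om_addk k l : (k < length l)%nat ->
  prodL om (addk k 1 l) * quad q1 q0 (IZR (ent (addk k 1 l) k)) = prodL om l * quad p1 p0 (IZR (ent l k)).
Proof.
  intros Hk. rewrite ent_addk by assumption. revert k Hk.
  induction l as [|x l IH]; intros k Hk; [cbn in Hk; lia|]. destruct k as [|k]; cbn [addk].
  - change (ent (x :: l) 0) with x. cbn.
    replace (om (x + 1)%Z * fold_right (fun x acc => om x * acc) 1 l * quad q1 q0 (IZR (x + 1)))
      with (om (x + 1)%Z * quad q1 q0 (IZR (x + 1)) * fold_right (fun x acc => om x * acc) 1 l) by ring.
    rewrite om_ratio. ring.
  - change (ent (x :: l) (S k)) with (ent l k). cbn [prodL fold_right].
    fold (prodL om l) (prodL om (addk k 1 l)). rewrite !Rmult_assoc, IH; [reflexivity|]. cbn in Hk. lia.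
Qed.

Definition flow_up (k : nat) (l : list Z) : R :=
  weight l * (vdm (addk k 1 l) / vdm l * quad p1 p0 (IZR (ent l k))).
Definition flow_down (k : nat) (l : list Z) : R :=
  weight l * (vdm (addk k (-1) l) / vdm l * quad q1 q0 (IZR (ent l k))).

(** One V of the squared Vandermonde cancels the denominator of the rate, so both sides are V(l)
    V(l+e_k) times a product of [om] and a rate, matched by the ratio of [om]. If just one end lies
    in Omega, one side has weight 0 and the other has a vanishing Vandermonde factor. *)
Lemma detailed_balance k l : length l = N -> (k < N)%nat -> flow_up k l = flow_down k (addk k 1 l).
Proof.
  intros Hl Hk. unfold flow_up, flow_down. rewrite addk_addk, addk_0.
  destruct (classic (inOmega N l)) as [H|H], (classic (inOmega N (addk k 1 l))) as [H'|H'].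
  - rewrite !weight_in by assumption.
    assert (V := vdm_neq0 _ (inOmega_NoDup _ _ H)). assert (V' := vdm_neq0 _ (inOmega_NoDup _ _ H')).
    assert (E := prodL_om_addk k l ltac:(lia)).
    replace (vdm l ^ 2 * prodL om l * (vdm (addk k 1 l) / vdm l * quad p1 p0 (IZR (ent l k))))
      with (vdm l * vdm (addk k 1 l) * (prodL om l * quad p1 p0 (IZR (ent l k)))) by (field; assumption).
    rewrite <- E. field. assumption.
  - rewrite (weight_out (addk k 1 l)) by assumption.
    rewrite (vdm_addk_boundary N k 1 l) by (assumption || lia). unfold Rdiv. ring.
  - rewrite (weight_out l) by assumption.
    assert (V : vdm l = 0).
    { assert (W := vdm_addk_boundary N k (-1) _ ltac:(lia) H'). rewrite addk_addk, addk_0 in W. now apply W. }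
    rewrite V. unfold Rdiv. ring.
  - rewrite !weight_out by assumption. ring.
Qed.

Lemma flow_up_bound : exists K, 0 <= K /\ forall k l, inOmega N l -> (k < N)%nat ->
  Rabs (flow_up k l) <= K * phi l * Rabs (weight l).
Proof.
  exists (2 ^ N * (1 + Rabs p1 + Rabs p0)). split.
  { assert (P1 := Rabs_pos p1). assert (P2 := Rabs_pos p0). apply Rmult_le_pos; [left; apply pow_lt|]; lra. }
  intros k l H Hk. unfold flow_up. rewrite !Rabs_mult, Rmult_comm.
  apply Rmult_le_compat_r; [apply Rabs_pos|]. rewrite Rmult_assoc.
  apply Rmult_le_compat; try apply Rabs_pos.
  - destruct H as [Hl Hs]. rewrite <- Hl. apply vdm_ratio_bound; [lia| |lia].
    now apply (inOmega_NoDup N).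
  - apply quad_bound, phi_in, nth_In. destruct H. lia.
Qed.

Definition flux (T : R) (f : list Z -> R) (k : nat) (l : list Z) : R :=
  flow_up k l * (psi T l * f (addk k 1 l) - f l * psi T (addk k 1 l)).

Lemma psi_pos T l : 0 < T -> 0 < psi T l.
Proof. intros H. assert (P := phi_ge_1 l). apply Rdiv_lt_0_compat; lra. Qed.

(** The flow grows like [phi], and each term carries a [psi] at [l] or at its neighbour. Since [phi]
    changes by a factor of at most 3, either one absorbs the growth: T + 3T = 4T. *)
Lemma flux_summable T f k : summable (fun l => length l = N) weight -> 0 < T -> C0 (inOmega N) f ->
  (k < N)%nat -> summable (fun l => length l = N) (flux T f k).
Proof.
  intros Hs HT Hf Hk. destruct (C0_bounded _ _ Hf) as (B & PB & HB).
  destruct flow_up_bound as (K & PK & HK).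
  apply (summable_dom _ _ weight (K * (4 * T * B)) Hs).
  { repeat apply Rmult_le_pos; lra. }
  intros l Hl. unfold flux.
  destruct (classic (inOmega N l)) as [H|H].
  2:{ unfold flow_up. rewrite (weight_out l) by assumption. rewrite !Rmult_0_l, Rabs_R0. lra. }
  (* The bound on [f] holds only on Omega, so the neighbour must lie there too; otherwise the flow
     is 0. *)
  destruct (classic (inOmega N (addk k 1 l))) as [H'|H'].
  2:{ unfold flow_up. rewrite (vdm_addk_boundary N k 1 l) by (assumption || lia).
      unfold Rdiv. rewrite !Rmult_0_l, Rmult_0_r, Rmult_0_l, Rabs_R0.
      apply Rmult_le_pos; [|apply Rabs_pos]. repeat apply Rmult_le_pos; lra. }
  rewrite Rabs_mult. eapply Rle_trans; [apply Rmult_le_compat_r; [apply Rabs_pos|now apply HK]|].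
  assert (B1 := HB _ H). assert (B2 := HB _ H').
  set (F := phi l). assert (PF : 1 <= F) by apply phi_ge_1.
  assert (PF' := phi_ge_1 (addk k 1 l)).
  assert (HF : F <= 3 * phi (addk k 1 l)).
  { rewrite phi_addk by lia. fold F. assert (Q : 1 + IZR (ent l k) ^ 2 <= F) by (apply phi_in, nth_In; lia).
    assert (Q2 := pow2_ge_0 (IZR (ent l k) + 3 / 2)). nra. }
  assert (S1 : F * psi T l <= T).
  { unfold psi. fold F. apply (Rmult_le_reg_r (T + F)); [lra|]. field_simplify; [nra|lra]. }
  assert (S2 : F * psi T (addk k 1 l) <= 3 * T).
  { unfold psi. set (G := phi (addk k 1 l)) in *.
    apply (Rmult_le_reg_r (T + G)); [lra|]. field_simplify; [nra|lra]. }
  assert (P1 := psi_pos T l HT). assert (P2 := psi_pos T (addk k 1 l) HT).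
  assert (Q : F * Rabs (psi T l * f (addk k 1 l) - f l * psi T (addk k 1 l)) <= 4 * T * B).
  { apply Rle_trans with (F * (psi T l * B + B * psi T (addk k 1 l))).
    - apply Rmult_le_compat_l; [lra|]. unfold Rminus. eapply Rle_trans; [apply Rabs_triang|].
      rewrite Rabs_Ropp, !Rabs_mult, (Rabs_pos_eq (psi T l)), (Rabs_pos_eq (psi T (addk k 1 l))) by lra.
      apply Rplus_le_compat; [apply Rmult_le_compat_l|apply Rmult_le_compat_r]; lra.
    - replace (F * (psi T l * B + B * psi T (addk k 1 l)))
        with ((F * psi T l) * B + (F * psi T (addk k 1 l)) * B) by ring.
      assert ((F * psi T l) * B <= T * B) by (apply Rmult_le_compat_r; lra).
      assert ((F * psi T (addk k 1 l)) * B <= 3 * T * B) by (apply Rmult_le_compat_r; lra). lra. }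
  replace (K * F * Rabs (weight l) * Rabs (psi T l * f (addk k 1 l) - f l * psi T (addk k 1 l)))
    with (K * (F * Rabs (psi T l * f (addk k 1 l) - f l * psi T (addk k 1 l))) * Rabs (weight l)) by ring.
  apply Rmult_le_compat_r; [apply Rabs_pos|]. now apply Rmult_le_compat_l.
Qed.

(* By detailed balance the summand is a discrete divergence, the divergence of [flux]. *)
Lemma gen_symmetric T f : summable (fun l => length l = N) weight -> 0 < T -> C0 (inOmega N) f ->
  has_sum (fun l => length l = N)
    (fun l => weight l * (psi T l * gen p1 p0 q1 q0 N f l - f l * gen p1 p0 q1 q0 N (psi T) l)) 0.
Proof.
  intros Hs HT Hf.
  apply (has_sum_ext _ (fun l => sumN (seq 0 N) (fun k => 1 * flux T f k l + (-1) * flux T f k (addk k (-1) l)))).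
  - intros l Hl. unfold gen. unfold Rminus.
    rewrite Rmult_plus_distr_l, Ropp_mult_distr_r, <- !Rmult_assoc, <- !sumN_scal.
    rewrite Ropp_mult_distr_r_reverse, Ropp_mult_distr_l. rewrite <- sumN_scal, <- sumN_plus.
    apply sumN_ext. intros k Hk. apply in_seq in Hk. unfold flux.
    rewrite (detailed_balance k (addk k (-1) l)) by (rewrite ?length_addk; lia).
    rewrite addk_addk, addk_0. unfold flow_up, flow_down. ring.
  - apply has_sum_sumN. intros k Hk. apply in_seq in Hk.
    destruct (summable_has_sum _ _ (flux_summable T f k Hs HT Hf ltac:(lia))) as [s Hsum].
    replace 0 with (1 * s + (-1) * s) by ring. apply has_sum_lin; [assumption|].
    apply (has_sum_reindex _ (fun l => length l = N) (addk k (-1)) (addk k 1)) with (g := flux T f k); try assumption.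
    + intros l Hl. now rewrite length_addk.
    + intros l _. now rewrite addk_addk, addk_0.
    + intros l Hl _. now rewrite length_addk, addk_addk, addk_0.
Qed.

(** The damping factor is at most 1, which settles all points where [u] is small. On the finitely
    many others u phi is bounded, and [T] is taken large compared with its sum. *)
Lemma C0_damped u eps : C0 (inOmega N) u -> 0 < eps -> exists T, 0 < T /\
  forall l, inOmega N l -> Rabs (u l) * (phi l / (T + phi l)) <= eps.
Proof.
  intros Hu He. destruct (Hu eps He) as [F HF].
  set (T := sumL F (fun l => Rabs (u l) * phi l) / eps + 1).
  assert (Pn : forall G, 0 <= sumL G (fun l => Rabs (u l) * phi l)).
  { intros G. apply sumL_nonneg. intros l _. assert (P := phi_ge_1 l). assert (Q := Rabs_pos (u l)). nra. }
  assert (PT : 0 < T).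
  { unfold T. assert (0 <= sumL F (fun l => Rabs (u l) * phi l) / eps); [|lra].
    now apply Rle_mult_inv_pos. }
  exists T. split; [assumption|]. intros l Hl. assert (P := phi_ge_1 l). assert (Q := Rabs_pos (u l)).
  destruct (in_dec lZ_dec l F) as [Hi|Hi].
  - assert (HT : Rabs (u l) * phi l <= eps * T).
    { unfold T. replace (eps * (sumL F (fun l => Rabs (u l) * phi l) / eps + 1))
        with (sumL F (fun l => Rabs (u l) * phi l) + eps) by (field; lra).
      destruct (in_split l F Hi) as (F1 & F2 & ->). rewrite sumL_app, sumL_cons.
      assert (P1 := Pn F1). assert (P2 := Pn F2). lra. }
    apply (Rmult_le_reg_r (T + phi l)); [lra|].
    replace (Rabs (u l) * (phi l / (T + phi l)) * (T + phi l)) with (Rabs (u l) * phi l) by (field; lra). nra.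
  - specialize (HF l Hl Hi). apply Rle_trans with (Rabs (u l) * 1); [|lra].
    apply Rmult_le_compat_l; [assumption|].
    apply (Rmult_le_reg_r (T + phi l)); [lra|]. unfold Rdiv. rewrite Rmult_assoc, Rinv_l by lra. lra.
Qed.

(** Subtracting the zero sum of [gen_symmetric] from [s] leaves the terms (1-psi) Df + f D psi. As
    1-psi = phi/(T+phi), they are at most (|Df| + K|f|) phi/(T+phi), and the bracket is a [C0]
    function, so [C0_damped] makes them uniformly small. *)
Lemma weight_gen_zero f s : summable (fun l => length l = N) weight ->
  C0 (inOmega N) f -> C0 (inOmega N) (gen p1 p0 q1 q0 N f) ->
  has_sum (fun l => length l = N) (fun l => weight l * gen p1 p0 q1 q0 N f l) s -> s = 0.
Proof.
  intros Hs Hf Hg Hsum. destruct (psi_gen_bound p1 p0 q1 q0 N) as (K & PK & HK).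
  assert (Hu := C0_abs_lin _ _ _ K PK Hf Hg). destruct Hs as [W HW].
  assert (PW : 0 <= W) by (apply (HW []); constructor).
  assert (Hle : forall eps, 0 < eps -> Rabs s <= eps * W).
  { intros eps He. destruct (C0_damped _ eps Hu He) as (T & PT & HT).
    assert (H0 := gen_symmetric T f (ex_intro _ W HW) PT Hf).
    assert (H1 := has_sum_lin _ _ _ _ _ 1 (-1) Hsum H0).
    replace (1 * s + -1 * 0) with s in H1 by ring.
    apply (has_sum_bound _ _ _ _ H1). intros F N1 N2.
    apply Rle_trans with (sumL F (fun l => eps * Rabs (weight l))).
    - apply sumL_le. intros l Hl.
      replace (1 * (weight l * gen p1 p0 q1 q0 N f l) +
        -1 * (weight l * (psi T l * gen p1 p0 q1 q0 N f l - f l * gen p1 p0 q1 q0 N (psi T) l)))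
       with (((1 - psi T l) * gen p1 p0 q1 q0 N f l + f l * gen p1 p0 q1 q0 N (psi T) l) * weight l) by ring.
      destruct (classic (inOmega N l)) as [H|H].
      2:{ rewrite (weight_out l H), Rmult_0_r, Rabs_R0. lra. }
      rewrite Rabs_mult. apply Rmult_le_compat_r; [apply Rabs_pos|].
      eapply Rle_trans; [|apply (HT l H)]. assert (P := phi_ge_1 l).
      replace (1 - psi T l) with (phi l / (T + phi l)) by (unfold psi; field; lra).
      assert (PP : 0 <= phi l / (T + phi l)) by (apply Rle_mult_inv_pos; lra).
      assert (B := HK T l PT H). eapply Rle_trans; [apply Rabs_triang|].
      rewrite !Rabs_mult, (Rabs_pos_eq (phi l / (T + phi l))) by assumption.
      assert (Q1 := Rabs_pos (f l)). assert (Q2 := Rabs_pos (gen p1 p0 q1 q0 N f l)).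
      rewrite (Rabs_pos_eq (Rabs _ + _)) by nra.
      assert (Rabs (f l) * Rabs (gen p1 p0 q1 q0 N (psi T) l) <= Rabs (f l) * (K * (phi l / (T + phi l))))
        by now apply Rmult_le_compat_l.
      lra.
    - rewrite sumL_scal. apply Rmult_le_compat_l; [lra|]. now apply HW. }
  assert (Rabs s <= 0).
  { apply le_epsilon. intros eps He.
    assert (H := Hle (eps / (W + 1)) ltac:(apply Rdiv_lt_0_compat; lra)).
    eapply Rle_trans; [exact H|]. rewrite Rplus_0_l.
    apply (Rmult_le_reg_r (W + 1)); [lra|].
    replace (eps / (W + 1) * W * (W + 1)) with (eps * W) by (field; lra). nra. }
  assert (P := Rabs_pos s). apply Rabs_eq_0. lra.
Qed.

End Weights.

(** * Invariance under the semigroup *)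

Lemma C0_dom Dm f g K : 0 <= K -> C0 Dm f -> (forall x, Dm x -> Rabs (g x) <= K * Rabs (f x)) -> C0 Dm g.
Proof.
  intros HK Hf H eps He. destruct (Hf (eps / (K + 1))) as [F HF]; [apply Rdiv_lt_0_compat; lra|].
  exists F. intros x Hx Hn. specialize (HF x Hx Hn). specialize (H x Hx).
  apply (Rmult_lt_compat_r (K + 1)) in HF; [|lra].
  unfold Rdiv in HF. rewrite Rmult_assoc, Rinv_l in HF by lra. assert (P := Rabs_pos (f x)). lra.
Qed.

Lemma C0_lin Dm f g a b : C0 Dm f -> C0 Dm g -> C0 Dm (fun x => a * f x + b * g x).
Proof.
  intros Hf Hg. assert (H := C0_abs_lin Dm f g 1 ltac:(lra) Hf Hg).
  assert (Pa := Rabs_pos a). assert (Pb := Rabs_pos b).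
  apply (C0_dom _ _ _ (Rabs a + Rabs b) ltac:(lra) H).
  intros x _. assert (Qf := Rabs_pos (f x)). assert (Qg := Rabs_pos (g x)).
  rewrite (Rabs_pos_eq (Rabs (g x) + 1 * Rabs (f x))) by lra. eapply Rle_trans; [apply Rabs_triang|]. rewrite !Rabs_mult. nra.
Qed.

Section Stationarity.

Variables (Dm : list Z -> Prop) (P : R -> (list Z -> R) -> list Z -> R)
  (D : (list Z -> R) -> list Z -> R) (w : list Z -> R).
Hypothesis P_feller : Feller_semigroup Dm P.
Hypothesis P_gen : generator_is Dm P D.
Hypothesis w_summable : summable Dm w.
Hypothesis D_finite_support : forall F f, (forall x, ~ In x F -> f x = 0) -> C0 Dm (D f).
Hypothesis w_D_zero : forall f s, C0 Dm f -> C0 Dm (D f) -> has_sum Dm (fun x => w x * D f x) s -> s = 0.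

Lemma P_C0 t f : 0 <= t -> C0 Dm f -> C0 Dm (P t f).
Proof. apply P_feller. Qed.

Lemma P_lin t a b f g x : 0 <= t -> C0 Dm f -> C0 Dm g -> Dm x ->
  P t (fun y => a * f y + b * g y) x = a * P t f x + b * P t g x.
Proof. intros. now apply P_feller. Qed.

(** The Feller axioms only speak of functions with values in [0,1], so f/e is split into its
    positive and negative parts. *)
Lemma P_contraction t f e : 0 <= t -> 0 < e -> C0 Dm f -> (forall x, Dm x -> Rabs (f x) <= e) ->
  forall x, Dm x -> Rabs (P t f x) <= e.
Proof.
  intros Ht He Hf Hb x Hx.
  destruct P_feller as (_ & Hext & _ & Hpos & _).
  assert (Hm : forall s, (s = 1 \/ s = -1) -> C0 Dm (fun y => Rmax (s * f y / e) 0) /\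
      0 <= P t (fun y => Rmax (s * f y / e) 0) x <= 1).
  { intros s Hs.
    assert (Hc : C0 Dm (fun y => Rmax (s * f y / e) 0)).
    { apply (C0_dom _ f _ (/ e)); [left; now apply Rinv_0_lt_compat|assumption|].
      intros y _. replace (/ e * Rabs (f y)) with (Rabs (s * f y / e)).
      - unfold Rmax. destruct Rle_dec; [rewrite Rabs_R0; apply Rabs_pos|lra].
      - unfold Rdiv. rewrite !Rabs_mult, (Rabs_pos_eq (/ e)) by (left; now apply Rinv_0_lt_compat).
        replace (Rabs s) with 1 by (destruct Hs; subst; abs_lra). ring. }
    split; [exact Hc|]. apply Hpos; try assumption. intros y Hy. specialize (Hb y Hy).
    split; [apply Rmax_r|]. apply Rmax_lub; [|lra].
    apply (Rmult_le_reg_r e); [assumption|]. unfold Rdiv. rewrite Rmult_assoc, Rinv_l by lra.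
    destruct Hs; subst; abs_lra. }
  destruct (Hm 1 (or_introl eq_refl)) as [C1 B1]. destruct (Hm (-1) (or_intror eq_refl)) as [C2 B2].
  rewrite (Hext t f (fun y => e * Rmax (1 * f y / e) 0 + (- e) * Rmax (-1 * f y / e) 0)); try assumption.
  - rewrite P_lin by assumption. apply Rabs_le. nra.
  - intros y _. unfold Rmax.
    assert (E : f y = e * (1 * f y / e)) by (field; lra).
    replace (-1 * f y / e) with (- (1 * f y / e)) by (field; lra).
    repeat destruct Rle_dec; rewrite E at 1; nra.
Qed.

Lemma pairing_exists g : C0 Dm g -> exists s, has_sum Dm (fun x => w x * g x) s.
Proof.
  intros Hg. destruct (C0_bounded _ _ Hg) as (B & PB & HB). apply summable_has_sum.
  apply (summable_dom _ _ w B w_summable PB). intros x Hx. rewrite Rabs_mult, Rmult_comm.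
  apply Rmult_le_compat_r; [apply Rabs_pos|now apply HB].
Qed.

Lemma pairing_bound : exists W, 0 <= W /\ forall g s e, 0 <= e -> (forall x, Dm x -> Rabs (g x) <= e) ->
  has_sum Dm (fun x => w x * g x) s -> Rabs s <= e * W.
Proof.
  destruct w_summable as [W HW]. exists W. split; [apply (HW []); constructor|].
  intros g s e He Hg Hs. apply (has_sum_bound _ _ _ _ Hs). intros F N1 N2.
  eapply Rle_trans; [apply (sumL_le F _ (fun x => e * Rabs (w x)))|].
  - intros x Hx. rewrite Rabs_mult, Rmult_comm. apply Rmult_le_compat_r; [apply Rabs_pos|].
    apply Hg. rewrite List.Forall_forall in N2. now apply N2.
  - rewrite sumL_scal. apply Rmult_le_compat_l; [assumption|now apply HW].
Qed.

(** Difference quotient minus generator, written as nested linear combinations so that [C0_lin] and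
    [P_lin] apply to it as it stands. *)
Definition diff_error (f : list Z -> R) (h : R) : list Z -> R :=
  fun y => 1 * (/ h * P h f y + (- / h) * f y) + (-1) * D f y.

Lemma diff_error_C0 f h : 0 <= h -> C0 Dm f -> C0 Dm (D f) -> C0 Dm (diff_error f h).
Proof.
  intros Hh Hf Hg. unfold diff_error. apply (C0_lin Dm (fun y => / h * P h f y + (- / h) * f y)); [|assumption].
  apply C0_lin; [now apply P_C0|assumption].
Qed.

Lemma P_diff_error f t h x : 0 <= t -> 0 < h -> C0 Dm f -> C0 Dm (D f) -> Dm x ->
  P (t + h) f x - P t f x = h * (P t (diff_error f h) x + P t (D f) x).
Proof.
  intros Ht Hh Hf Hg Hx. assert (HP := P_C0 h f ltac:(lra) Hf). unfold diff_error.
  rewrite (P_lin t 1 (-1) (fun y => / h * P h f y + (- / h) * f y)) by (try assumption; now apply C0_lin).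
  rewrite P_lin by assumption.
  destruct P_feller as (_ & _ & _ & _ & _ & Hsg & _). rewrite Hsg by (assumption || lra).
  field. lra.
Qed.

(** The generator limit is uniform in x, and contraction carries the bound through [P t]; so [delta]
    depends neither on [x] nor on [t]. *)
Lemma diff_error_small f eps : C0 Dm f -> C0 Dm (D f) -> 0 < eps -> exists delta, 0 < delta /\
  forall h, 0 < h < delta -> forall t x, 0 <= t -> Dm x -> Rabs (P t (diff_error f h) x) <= eps.
Proof.
  intros Hf Hg He. destruct (proj2 (P_gen f (D f) Hf) (conj Hg (fun x _ => eq_refl))) as [_ Hlim].
  destruct (Hlim eps He) as (delta & Hd & Hb). exists delta. split; [assumption|].
  intros h Hh t x Ht Hx. apply P_contraction; try assumption.
  - apply diff_error_C0; [lra|assumption|assumption].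
  - intros y Hy. specialize (Hb h Hh y Hy). unfold diff_error.
    replace (1 * (/ h * P h f y + - / h * f y) + -1 * D f y) with ((P h f y - f y) / h - D f y) by (field; lra).
    exact Hb.
Qed.

(** By the semigroup law the difference quotient of [P t f] is [P t] applied to that of [f], so
    [P t f] lies in the domain and its generator value is [P t (D f)]. Here [w_D_zero] is applied to
    [P t f], whose support is in general infinite. *)
Lemma P_D_pairing_zero f t : 0 <= t -> C0 Dm f -> C0 Dm (D f) -> has_sum Dm (fun x => w x * P t (D f) x) 0.
Proof.
  intros Ht Hf Hg.
  assert (HG : gen_at Dm P (P t f) (P t (D f))).
  { split; [now apply P_C0|]. intros eps He.
    destruct (diff_error_small f eps Hf Hg He) as (delta & Hd & Hb). exists delta. split; [assumption|].
    intros h Hh x Hx. specialize (Hb h Hh t x Ht Hx).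
    assert (E := P_diff_error f t h x Ht ltac:(lra) Hf Hg Hx).
    destruct P_feller as (_ & _ & _ & _ & _ & Hsg & _).
    rewrite <- Hsg by (assumption || lra). rewrite (Rplus_comm h t), E.
    replace (h * (P t (diff_error f h) x + P t (D f) x) / h - P t (D f) x)
      with (P t (diff_error f h) x) by (field; lra). exact Hb. }
  assert (HPt := P_C0 t f Ht Hf).
  destruct (proj1 (P_gen _ _ HPt) HG) as [Hc He].
  destruct (pairing_exists _ Hc) as [s Hs].
  rewrite (w_D_zero _ s HPt Hc Hs) in Hs. revert Hs. apply has_sum_ext.
  intros x Hx. now rewrite He.
Qed.

(** Replaces differentiation in t. Each of the n steps of length h changes the pairing by at most h
    eps W, because the part with [P t (D f)] pairs to 0; the total t eps W does not depend on n. *)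
Lemma domain_stationary f t s0 s1 : 0 <= t -> C0 Dm f -> C0 Dm (D f) ->
  has_sum Dm (fun x => w x * P 0 f x) s0 -> has_sum Dm (fun x => w x * P t f x) s1 -> s1 = s0.
Proof.
  intros Ht Hf Hg H0 H1. destruct pairing_bound as (W & PW & HW).
  destruct (Req_dec t 0) as [->|Hne]; [eapply has_sum_unique; eassumption|].
  assert (Hle : forall eps, 0 < eps -> Rabs (s1 - s0) <= eps * (t * W)).
  { intros eps He. destruct (diff_error_small f eps Hf Hg He) as (delta & Hd & Hb).
    destruct (INR_unbounded (t / delta)) as [n Hn].
    assert (Pn : 0 < INR n) by (assert (0 < t / delta) by (apply Rdiv_lt_0_compat; lra); lra).
    set (h := t / INR n).
    assert (Hh : 0 < h < delta).
    { split; [apply Rdiv_lt_0_compat; lra|]. unfold h. apply (Rmult_lt_reg_r (INR n)); [assumption|].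
      unfold Rdiv. rewrite Rmult_assoc, Rinv_l by lra.
      apply (Rmult_lt_compat_r delta) in Hn; [|assumption].
      unfold Rdiv in Hn. rewrite Rmult_assoc, Rinv_l in Hn by lra. lra. }
    assert (Hk : forall k s, has_sum Dm (fun x => w x * P (INR k * h) f x) s -> Rabs (s - s0) <= INR k * (h * (eps * W))).
    { induction k as [|k IH]; intros s Hs.
      - cbn [INR] in *. rewrite Rmult_0_l in *. rewrite (has_sum_unique _ _ _ _ Hs H0), Rminus_diag, Rabs_R0. lra.
      - rewrite S_INR in *.
        assert (Pk : 0 <= INR k * h) by (apply Rmult_le_pos; [apply pos_INR|lra]).
        destruct (pairing_exists _ (P_C0 (INR k * h) f Pk Hf)) as [s' Hs'].
        specialize (IH s' Hs'). assert (Hz := P_D_pairing_zero f (INR k * h) Pk Hf Hg).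
        destruct (pairing_exists _ (P_C0 _ _ Pk (diff_error_C0 f h ltac:(lra) Hf Hg))) as [e Hes].
        assert (Be := HW _ e eps ltac:(lra) (fun x Hx => Hb h Hh _ x Pk Hx) Hes).
        assert (E : s = 1 * s' + h * (1 * e + 1 * 0)).
        { apply (has_sum_unique _ _ _ _ Hs).
          generalize (has_sum_lin _ _ _ _ _ 1 h Hs' (has_sum_lin _ _ _ _ _ 1 1 Hes Hz)).
          apply has_sum_ext. intros x Hx. replace ((INR k + 1) * h) with (INR k * h + h) by ring.
          assert (E := P_diff_error f (INR k * h) h x Pk ltac:(lra) Hf Hg Hx).
          replace (P (INR k * h + h) f x) with (P (INR k * h) f x +
            h * (P (INR k * h) (diff_error f h) x + P (INR k * h) (D f) x)) by lra. ring. }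
        replace (s - s0) with ((s' - s0) + h * e) by lra.
        eapply Rle_trans; [apply Rabs_triang|]. rewrite Rabs_mult, (Rabs_pos_eq h) by lra.
        assert (h * Rabs e <= h * (eps * W)) by (apply Rmult_le_compat_l; lra). lra. }
    replace t with (INR n * h) in H1 by (unfold h; field; lra).
    specialize (Hk n s1 H1). unfold h in Hk.
    replace (eps * (t * W)) with (INR n * (t / INR n * (eps * W))) by (field; lra). exact Hk. }
  assert (Rabs (s1 - s0) <= 0).
  { apply le_epsilon. intros eps He. assert (PtW : 0 <= t * W) by now apply Rmult_le_pos.
    eapply Rle_trans; [apply (Hle (eps / (t * W + 1))); apply Rdiv_lt_0_compat; lra|].
    apply (Rmult_le_reg_r (t * W + 1)); [lra|].
    replace (eps / (t * W + 1) * (t * W) * (t * W + 1)) with (eps * (t * W)) by (field; lra). nra. }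
  assert (Q := Rabs_pos (s1 - s0)). assert (s1 - s0 = 0) by (apply Rabs_eq_0; lra). lra.
Qed.

Lemma stationary f t : 0 <= t -> C0 Dm f -> exists s,
  has_sum Dm (fun x => w x * P t f x) s /\ has_sum Dm (fun x => w x * f x) s.
Proof.
  intros Ht Hf. destruct pairing_bound as (W & PW & HW).
  destruct (pairing_exists _ (P_C0 t f Ht Hf)) as [s1 H1].
  destruct (pairing_exists f Hf) as [s0 H0]. exists s0. split; [|assumption].
  replace s0 with s1; [assumption|].
  assert (Hle : forall eps, 0 < eps -> Rabs (s1 - s0) <= 2 * eps * W).
  { intros eps He. destruct (Hf eps He) as [F HF].
    (* Truncation to a finite set stays within [eps] of [f] on [Dm] and lands in the domain by
       [D_finite_support]. The two pairings are each off by eps W, hence the factor 2. *)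
    set (f' := fun x => if in_dec lZ_dec x F then f x else 0).
    assert (Hf' : C0 Dm f').
    { apply (C0_dom _ f _ 1); [lra|assumption|]. intros x _. unfold f'.
      destruct in_dec; rewrite ?Rabs_R0; assert (Q := Rabs_pos (f x)); lra. }
    assert (HDf' : C0 Dm (D f')).
    { apply (D_finite_support F). intros x Hx. unfold f'. now destruct in_dec. }
    destruct (pairing_exists _ (P_C0 t f' Ht Hf')) as [s1' H1'].
    destruct (pairing_exists f' Hf') as [s0' H0'].
    assert (E : s1' = s0').
    { apply (domain_stationary f' t s0' s1' Ht Hf' HDf'); [|assumption].
      revert H0'. apply has_sum_ext. intros x Hx. f_equal. symmetry. now apply P_feller. }
    assert (Hdiff : forall x, Dm x -> Rabs (1 * f x + (-1) * f' x) <= eps).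
    { intros x Hx. unfold f'. destruct in_dec as [Hi|Hi].
      - replace (1 * f x + -1 * f x) with 0 by ring. rewrite Rabs_R0. lra.
      - left. replace (1 * f x + -1 * 0) with (f x) by ring. now apply HF. }
    assert (B0 : Rabs (1 * s0 + (-1) * s0') <= eps * W).
    { apply (HW (fun x => 1 * f x + (-1) * f' x)); [lra|assumption|].
      generalize (has_sum_lin _ _ _ _ _ 1 (-1) H0 H0'). apply has_sum_ext. intros; ring. }
    assert (B1 : Rabs (1 * s1 + (-1) * s1') <= eps * W).
    { apply (HW (P t (fun x => 1 * f x + (-1) * f' x))); [lra| |].
      - intros x Hx. apply P_contraction; try assumption. now apply C0_lin.
      - generalize (has_sum_lin _ _ _ _ _ 1 (-1) H1 H1'). apply has_sum_ext.
        intros x Hx. rewrite P_lin by assumption. ring. }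
    subst s1'. replace (s1 - s0) with ((1 * s1 + -1 * s0') - (1 * s0 + -1 * s0')) by ring.
    rewrite Rabs_le_between in *. lra. }
  assert (Rabs (s1 - s0) <= 0).
  { apply le_epsilon. intros eps He.
    eapply Rle_trans; [apply (Hle (eps / (2 * (W + 1)))); apply Rdiv_lt_0_compat; lra|].
    apply (Rmult_le_reg_r (W + 1)); [lra|].
    replace (2 * (eps / (2 * (W + 1))) * W * (W + 1)) with (eps * W) by (field; lra). nra. }
  assert (Q := Rabs_pos (s1 - s0)). assert (s1 - s0 = 0) by (apply Rabs_eq_0; lra). lra.
Qed.

End Stationarity.

(** * The zw-measure *)

Lemma shift_shift c d e f l : shift e f (shift c d l) = shift (c + e) (d + f) l.
Proof.
  revert c e. induction l as [|x l IH]; intros c e; cbn; [reflexivity|]. rewrite IH. f_equal; [lia|].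
  f_equal. lia.
Qed.

Lemma shift_0 l : shift 0 0 l = l.
Proof. induction l as [|x l IH]; cbn; [reflexivity|]. rewrite IH. f_equal. lia. Qed.

Lemma toS_toOmega N nu : toS N (toOmega N nu) = nu.
Proof.
  unfold toS, toOmega. rewrite shift_shift.
  replace (Z.of_nat N - 1 + (1 - Z.of_nat N))%Z with 0%Z by lia. apply shift_0.
Qed.

Lemma toOmega_toS N n : toOmega N (toS N n) = n.
Proof.
  unfold toS, toOmega. rewrite shift_shift.
  replace (1 - Z.of_nat N + (Z.of_nat N - 1))%Z with 0%Z by lia. apply shift_0.
Qed.

Lemma length_shift c d l : length (shift c d l) = length l.
Proof. revert c. induction l; intros c; cbn; auto. Qed.

Lemma ent_shift c d l i : (i < length l)%nat -> ent (shift c d l) i = (ent l i + c + Z.of_nat i * d)%Z.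
Proof.
  revert c i. induction l as [|x l IH]; intros c i Hi; [cbn in Hi; lia|]. destruct i as [|i].
  - cbn. lia.
  - change (ent (shift c d (x :: l)) (S i)) with (ent (shift (c + d) d l) i).
    rewrite IH by (cbn in Hi; lia). change (ent (x :: l) (S i)) with (ent l i). lia.
Qed.

Lemma ent_toOmega N nu i : length nu = N -> (i < N)%nat ->
  ent (toOmega N nu) i = (ent nu i + Z.of_nat N - 1 - Z.of_nat i)%Z.
Proof. intros Hl Hi. unfold toOmega. rewrite ent_shift by lia. lia. Qed.

Lemma toOmega_inOmega N nu : inS N nu -> inOmega N (toOmega N nu).
Proof.
  intros [Hl Hs]. split; [unfold toOmega; now rewrite length_shift|]. unfold toOmega.
  generalize (Z.of_nat N - 1)%Z. clear Hl. induction Hs as [|x l Hl IH Hx]; intros c; constructor; [apply IH|].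
  inversion Hx; cbn; constructor. lia.
Qed.

Lemma toS_inS N n : inOmega N n -> inS N (toS N n).
Proof.
  intros [Hl Hs]. split; [unfold toS; now rewrite length_shift|]. unfold toS.
  generalize (1 - Z.of_nat N)%Z. clear Hl. induction Hs as [|x l Hl IH Hx]; intros c; constructor; [apply IH|].
  inversion Hx; cbn; constructor. lia.
Qed.

Lemma C0_toS N f : C0 (inS N) f -> C0 (inOmega N) (fun n => f (toS N n)).
Proof.
  intros H eps He. destruct (H eps He) as [F HF]. exists (map (toOmega N) F). intros n Hn Hi.
  apply HF; [now apply toS_inS|]. intros Hi'. apply Hi. rewrite <- (toOmega_toS N n). now apply in_map.
Qed.

Lemma prodR_mult l f g : prodR l (fun i => f i * g i) = prodR l f * prodR l g.
Proof.
  induction l as [|i l IH]; [cbn; ring|].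
  change (f i * g i * prodR l (fun i => f i * g i) = f i * prodR l f * (g i * prodR l g)).
  rewrite IH. ring.
Qed.

Lemma DimN_vdm N nu : length nu = N ->
  DimN N nu = vdm (toOmega N nu) *
    prodR (seq 0 N) (fun i => prodR (seq (S i) (N - S i)) (fun j => / (INR j - INR i))).
Proof.
  intros Hl. rewrite <- Vdm_vdm. unfold toOmega at 1. rewrite length_shift, Hl.
  unfold DimN, Vdm. rewrite <- prodR_mult. apply prodR_ext. intros i Hi. apply in_seq in Hi.
  rewrite <- prodR_mult. apply prodR_ext. intros j Hj. apply in_seq in Hj.
  rewrite !ent_toOmega by lia. unfold Rdiv. f_equal.
  rewrite !minus_IZR, !plus_IZR, <- !INR_IZR_INZ. ring.
Qed.

Lemma prodR_ent (om : Z -> R) l : prodR (seq 0 (length l)) (fun i => om (ent l i)) = prodL om l.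
Proof.
  induction l as [|y l IH]; [reflexivity|]. cbn [length seq]. rewrite <- seq_shift.
  change (prodR (0%nat :: map S (seq 0 (length l))) (fun i => om (ent (y :: l) i)))
    with (om y * prodR (map S (seq 0 (length l))) (fun i => om (ent (y :: l) i))).
  rewrite prodR_map, prodL_cons. f_equal. exact IH.
Qed.

Lemma prodC_ext l f g : (forall i, In i l -> f i = g i) -> prodC l f = prodC l g.
Proof.
  induction l as [|i l IH]; intros H; cbn; [reflexivity|]. rewrite H by now left. f_equal.
  apply IH. intros j Hj. apply H. now right.
Qed.

Lemma prodC_scal_real (c : C) (f : nat -> R) l :
  prodC l (fun i => (c * RtoC (f i))%C) = (Cpow c (length l) * RtoC (prodR l f))%C.
Proof.
  induction l as [|i l IH].
  - change ((RtoC 1) = (RtoC 1 * RtoC 1)%C). ring.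
  - change ((c * RtoC (f i) * prodC l (fun i => (c * RtoC (f i))%C))%C =
      (c * Cpow c (length l) * RtoC (f i * prodR l f))%C).
    rewrite IH, RtoC_mult. ring.
Qed.

Section ZW.

Variables (z z' w w' : Cx) (N : nat).
Hypothesis adm : admissible z z' w w'.

(** The coefficients of the two jump rates as monic quadratics in x. Real parts are taken;
    admissibility makes the imaginary parts of the rates vanish at integers. *)
Let M : R := INR N - 1.
Let p1 : R := - (fst z + fst z' + 2 * M).
Let p0 : R := (fst z + M) * (fst z' + M) - snd z * snd z'.
Let q1 : R := fst w + fst w'.
Let q0 : R := fst w * fst w' - snd w * snd w'.

Lemma up_rate_real x :
  Cmul (Cadd z (CofZ (Z.of_nat N - 1 - x))) (Cadd z' (CofZ (Z.of_nat N - 1 - x))) = RtoC (quad p1 p0 (IZR x)).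
Proof.
  destruct adm as (Hz & _ & _). destruct (Hz (Z.of_nat N - 1 - x)%Z) as [Him _].
  apply injective_projections; [|exact Him].
  unfold Cmul, Cadd, CofZ, RtoC, quad, p1, p0, M; cbn [fst snd].
  rewrite !minus_IZR, <- INR_IZR_INZ. ring.
Qed.

Lemma down_rate_real x :
  Cmul (Cadd w (CofZ x)) (Cadd w' (CofZ x)) = RtoC (quad q1 q0 (IZR x)).
Proof.
  destruct adm as (_ & Hw & _). destruct (Hw x) as [Him _].
  apply injective_projections; [|exact Him].
  unfold Cmul, Cadd, CofZ, RtoC, quad, q1, q0; cbn [fst snd]. ring.
Qed.

Lemma up_rate_pos x : 0 < quad p1 p0 (IZR x).
Proof.
  destruct adm as (Hz & _ & _). destruct (Hz (Z.of_nat N - 1 - x)%Z) as [_ Hre].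
  rewrite up_rate_real in Hre. exact Hre.
Qed.

Lemma down_rate_pos x : 0 < quad q1 q0 (IZR x).
Proof.
  destruct adm as (_ & Hw & _). destruct (Hw x) as [_ Hre].
  rewrite down_rate_real in Hre. exact Hre.
Qed.

Lemma Dop_gen f l : length l = N -> Dop z z' w w' N f l = gen p1 p0 q1 q0 N f l.
Proof.
  intros Hl. unfold Dop, gen. apply sumN_ext. intros k _.
  rewrite up_rate_real, down_rate_real. cbn [Cre RtoC fst].
  assert (V : forall m, length m = N -> Vdm N m = vdm m) by (intros m <-; apply Vdm_vdm).
  rewrite !V by (rewrite ?length_addk; assumption). reflexivity.
Qed.

Lemma Dop_finite_support F f : (forall x, ~ In x F -> f x = 0) -> C0 (inOmega N) (Dop z z' w w' N f).
Proof.
  intros Hf eps He.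
  (* The support together with its neighbours in every direction; elsewhere every term of the
     operator is 0. *)
  exists (F ++ flat_map (fun k => map (addk k (-1)) F ++ map (addk k 1) F) (seq 0 N)).
  intros x Hx Hn. rewrite Dop_gen by apply Hx.
  assert (E : forall k d e, (k < N)%nat -> (d + e = 0)%Z -> (e = -1 \/ e = 1)%Z -> f (addk k d x) = 0).
  { intros k d e Hk Hde He'. apply Hf. intros Hi. apply Hn. apply in_or_app. right.
    apply in_flat_map. exists k. split; [apply in_seq; lia|].
    assert (In x (map (addk k e) F)).
    { apply in_map_iff. exists (addk k d x). split; [|assumption]. now rewrite addk_addk, Hde, addk_0. }
    apply in_or_app. destruct He' as [-> | ->]; tauto. }
  assert (E0 : f x = 0) by (apply Hf; intros Hi; apply Hn, in_or_app; now left).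
  unfold gen. rewrite (sumN_ext _ _ (fun k => 0 * 0)).
  - rewrite sumN_scal, Rmult_0_l, Rabs_R0. assumption.
  - intros k Hk. apply in_seq in Hk.
    rewrite (E k 1%Z (-1)%Z), (E k (-1)%Z 1%Z), E0 by (lia || auto). ring.
Qed.

Lemma exists_one_particle_weight : exists om : Z -> R, (forall x, 0 < om x) /\
  forall x, om (x + 1)%Z * quad q1 q0 (IZR (x + 1)) = om x * quad p1 p0 (IZR x).
Proof.
  destruct (exists_ratio (fun x => quad p1 p0 (IZR x) / quad q1 q0 (IZR (x + 1)))) as (om & Hpos & Hom).
  - intros x. apply Rdiv_lt_0_compat; [apply up_rate_pos|apply down_rate_pos].
  - exists om. split; [assumption|]. intros x. rewrite Hom. field. apply Rgt_not_eq, down_rate_pos.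
Qed.

(** The four reciprocal Gamma values of the zw-weight in the coordinate x = nu_i + N - i, with i
    counted from 1. *)
Definition gamma_factor (x : Z) : C :=
  Cmul (Cmul (rgamma (Cadd z (CofZ (Z.of_nat N - x)))) (rgamma (Cadd z' (CofZ (Z.of_nat N - x)))))
       (Cmul (rgamma (Cadd w (CofZ (x + 1)))) (rgamma (Cadd w' (CofZ (x + 1))))).

Lemma rgamma_step s k : rgamma (Cadd s (CofZ k)) = (Cadd s (CofZ k) * rgamma (Cadd s (CofZ (k + 1))))%C.
Proof.
  rewrite rgamma_succ at 1. f_equal. f_equal.
  unfold Cadd, CofZ, Cplus, RtoC; cbn [fst snd]. rewrite plus_IZR. f_equal; ring.
Qed.

Lemma gamma_factor_ratio x :
  (gamma_factor (x + 1) * RtoC (quad q1 q0 (IZR (x + 1))) = gamma_factor x * RtoC (quad p1 p0 (IZR x)))%C.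
Proof.
  rewrite <- up_rate_real, <- down_rate_real. unfold gamma_factor. change Cmul with Cmult.
  rewrite (rgamma_step w (x + 1)), (rgamma_step w' (x + 1)).
  rewrite (rgamma_step z (Z.of_nat N - (x + 1))), (rgamma_step z' (Z.of_nat N - (x + 1))).
  replace (Z.of_nat N - (x + 1) + 1)%Z with (Z.of_nat N - x)%Z by lia.
  replace (Z.of_nat N - (x + 1))%Z with (Z.of_nat N - 1 - x)%Z by lia. ring.
Qed.

(** Both functions satisfy the same recursion on the integers with nonzero coefficients, so their
    quotient is constant. It may be complex here; the real part is taken later, of its [N]-th
    power. *)
Lemma gamma_factor_om om : (forall x, 0 < om x) ->
  (forall x, om (x + 1)%Z * quad q1 q0 (IZR (x + 1)) = om x * quad p1 p0 (IZR x)) ->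
  exists c : C, forall x, gamma_factor x = (c * RtoC (om x))%C.
Proof.
  intros Hpos Hom.
  assert (N0 : forall r, 0 < r -> RtoC r <> RtoC 0) by (intros r Hr E; apply RtoC_inj in E; lra).
  set (c := fun x => (gamma_factor x / RtoC (om x))%C).
  assert (Hc : forall x, c (x + 1)%Z = c x).
  { intros x. unfold c. assert (E := gamma_factor_ratio x). assert (E' := f_equal RtoC (Hom x)).
    rewrite !RtoC_mult in E'.
    assert (Q := N0 _ (down_rate_pos (x + 1))). assert (O1 := N0 _ (Hpos x)). assert (O2 := N0 _ (Hpos (x + 1)%Z)).
    assert (Q' := N0 _ (up_rate_pos x)).
    replace (gamma_factor (x + 1) / RtoC (om (x + 1)%Z))%C
      with ((gamma_factor (x + 1) * RtoC (quad q1 q0 (IZR (x + 1)))) / (RtoC (om (x + 1)%Z) * RtoC (quad q1 q0 (IZR (x + 1)))))%C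
      by (field; split; assumption).
    rewrite E, E'. field. split; assumption. }
  assert (Hc0 : forall x, c x = c 0%Z).
  { intros x. induction x using Z.peano_ind; [reflexivity| |].
    - rewrite <- IHx, <- (Hc x). f_equal.
    - rewrite <- IHx, <- (Hc (Z.pred x)). f_equal. lia. }
  exists (c 0%Z). intros x. rewrite <- (Hc0 x). unfold c. field. now apply N0.
Qed.

Lemma zw_weight_eq om : (forall x, 0 < om x) ->
  (forall x, om (x + 1)%Z * quad q1 q0 (IZR (x + 1)) = om x * quad p1 p0 (IZR x)) ->
  exists K, forall nu, inS N nu -> zw_weight z z' w w' N nu = K * weight om N (toOmega N nu).
Proof.
  intros Hpos Hom. destruct (gamma_factor_om om Hpos Hom) as [c Hc].
  set (kap := prodR (seq 0 N) (fun i => prodR (seq (S i) (N - S i)) (fun j => / (INR j - INR i)))).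
  exists (fst (Cpow c N) * kap ^ 2). intros nu Hnu. assert (Hl := proj1 Hnu).
  unfold zw_weight. rewrite DimN_vdm by assumption. fold kap.
  rewrite weight_in by now apply toOmega_inOmega.
  rewrite (prodC_ext _ _ (fun i => (c * RtoC (om (ent (toOmega N nu) i)))%C)).
  2:{ intros i Hi. apply in_seq in Hi. rewrite <- Hc. unfold gamma_factor.
      rewrite ent_toOmega by lia. cbv zeta.
      replace (Z.of_nat N - (ent nu i + Z.of_nat N - 1 - Z.of_nat i))%Z
        with (- ent nu i + Z.of_nat i + 1)%Z by lia.
      replace (ent nu i + Z.of_nat N - 1 - Z.of_nat i + 1)%Z
        with (Z.of_nat N + ent nu i - Z.of_nat i)%Z by lia.
      reflexivity. }
  rewrite prodC_scal_real, length_seq.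
  assert (E := prodR_ent om (toOmega N nu)).
  replace (length (toOmega N nu)) with N in E by (unfold toOmega; now rewrite length_shift).
  rewrite E. generalize (Cpow c N). intros [a b]. unfold Cre, Cmult, RtoC; cbn [fst snd]. ring.
Qed.

Lemma weight_summable_S om : (1 <= N)%nat -> (forall x, 0 < om x) ->
  (forall x, om (x + 1)%Z * quad q1 q0 (IZR (x + 1)) = om x * quad p1 p0 (IZR x)) ->
  summable (fun l => length l = N) (weight om N).
Proof.
  intros HN Hpos Hom. apply (weight_summable p1 p0 q1 q0); try assumption.
  - exact up_rate_pos.
  - exact down_rate_pos.
  (* The 2(N-1) from the Vandermonde cancels the one inside [p1]. What remains is -Re(z+z'+w+w') - 2
     < -1, the last admissibility condition. *)
  - destruct adm as (_ & _ & Hs). unfold Cadd, Cre in Hs. cbn [fst] in Hs.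
    rewrite mult_INR. replace N with (S (pred N)) at 2 3 by lia.
    unfold p1, q1, M. replace (INR N) with (INR (pred N) + 1) by (rewrite <- S_INR; f_equal; lia).
    cbn [pred]. replace (INR 2) with 2 by (cbn; ring).
    lra.
Qed.

(** Mediates between the index sets: the semigroup lives on Omega, while summation by parts ran over
    all lists of length [N]. *)
Lemma weight_Dop_zero om :
  (forall x, om (x + 1)%Z * quad q1 q0 (IZR (x + 1)) = om x * quad p1 p0 (IZR x)) ->
  summable (fun l => length l = N) (weight om N) ->
  forall f s, C0 (inOmega N) f -> C0 (inOmega N) (Dop z z' w w' N f) ->
  has_sum (inOmega N) (fun l => weight om N l * Dop z z' w w' N f l) s -> s = 0.
Proof.
  intros Hom Hs f s Hf HD Hsum.
  assert (HG : C0 (inOmega N) (gen p1 p0 q1 q0 N f)).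
  { apply (C0_dom _ _ _ 1 ltac:(lra) HD). intros l [Hl _].
    rewrite Rmult_1_l, Dop_gen by assumption. apply Rle_refl. }
  destruct (C0_bounded _ _ HG) as (B & PB & HB).
  destruct (summable_has_sum (fun l => length l = N) (fun l => weight om N l * gen p1 p0 q1 q0 N f l))
    as [s' Hs'].
  { apply (summable_dom _ _ _ B Hs PB). intros l _. rewrite Rabs_mult, Rmult_comm.
    destruct (classic (inOmega N l)) as [H|H].
    - apply Rmult_le_compat_r; [apply Rabs_pos|now apply HB].
    - rewrite weight_out, Rabs_R0 by assumption. lra. }
  assert (E := weight_gen_zero _ _ _ _ om N Hom f s' Hs Hf HG Hs'). subst s'.
  apply (has_sum_unique _ _ _ _ Hsum).
  apply (has_sum_reindex (inOmega N) _ (fun l => l) (fun l => l)) in Hs'; try tauto.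
  - revert Hs'. apply has_sum_ext. intros l [Hl _]. now rewrite Dop_gen.
  - now intros l [Hl _].
  - intros l _ Hne. split; [|reflexivity]. apply NNPP. intros H. apply Hne.
    rewrite weight_out by assumption. ring.
Qed.

End ZW.

Theorem theorem5 (z z' w w' : Cx) (N : nat)
  (P : R -> (list Z -> R) -> list Z -> R) :
  admissible z z' w w' -> (1 <= N)%nat ->
  Feller_semigroup (inOmega N) P ->
  generator_is (inOmega N) P (Dop z z' w w' N) ->
  forall (t : R) (f : list Z -> R), 0 <= t -> C0 (inS N) f ->
  exists s : R,
    has_sum (inS N) (fun nu => zw_measure z z' w w' N nu * transportS N P t f nu) s /\
    has_sum (inS N) (fun nu => zw_measure z z' w w' N nu * f nu) s.
Proof.
  intros adm HN HP HG t f Ht Hf.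
  destruct (exists_one_particle_weight z z' w w' N adm) as (om & Hpos & Hom).
  destruct (zw_weight_eq z z' w w' N adm om Hpos Hom) as [K HK].
  assert (Hs := weight_summable_S z z' w w' N adm om HN Hpos Hom).
  assert (Hs' : summable (inOmega N) (weight om N)).
  { destruct Hs as [B HB]. exists B. intros F N1 N2. apply HB; [assumption|].
    revert N2. apply List.Forall_impl. now intros l [Hl _]. }
  destruct (stationary (inOmega N) P (Dop z z' w w' N) (weight om N) HP HG Hs'
    (Dop_finite_support z z' w w' N adm)) with (f := fun n => f (toS N n)) (t := t) as (s & S1 & S2).
  - intros g s. exact (weight_Dop_zero z z' w w' N adm om Hom Hs g s).
  - assumption.
  - now apply C0_toS.
  (* Stationarity is linear in the measure, so it was proved for the unnormalized [weight]. Both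
     pairings are now multiplied by the same constant. *)
  - assert (R : forall g v, has_sum (inOmega N) (fun x => weight om N x * g x) v ->
       has_sum (inS N) (fun nu => zw_measure z z' w w' N nu * g (toOmega N nu)) (K / zw_total z z' w w' N * v)).
    { intros g v Hv.
      apply (has_sum_reindex (inS N) _ (toOmega N) (toS N)) in Hv.
      - apply (has_sum_scal _ _ _ (K / zw_total z z' w w' N)) in Hv. revert Hv. apply has_sum_ext.
        intros nu Hnu. unfold zw_measure. rewrite HK by assumption. unfold Rdiv. ring.
      - apply toOmega_inOmega.
      - intros; apply toS_toOmega.
      - intros n Hn _. split; [now apply toS_inS|apply toOmega_toS]. }
    exists (K / zw_total z z' w w' N * s). split.
    + exact (R _ s S1).
    + generalize (R _ s S2). apply has_sum_ext. intros nu _. now rewrite toS_toOmega.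
Qed.
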